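(* Fix $y\in\mathbb{R}$. For each $N$ let $\mathcal{D}_{\mathrm{obs}}=(X_i)_{1\le i\le n_N}$ be $n_N$ i.i.d. observational samples and $\mathcal{D}_{\mathrm{int}}=(Y_i)_{1\le i\le m_N}$ be $m_N$ i.i.d. interventional samples under $do(Y(2)=y)$, independent of the observational ones, all generated by the same true model, with $n_N+m_N=N$, $n_N$ and $m_N$ increasing in $N$, and $n_N/N\to\eta\in(0,1)$. Let $\mathcal{D}_{\mathrm{mix}}=\mathcal{D}_{\mathrm{obs}}\cup\mathcal{D}_{\mathrm{int}}$. Assume that the prior densities $\pi(\theta\mid S)$ are four times differentiable for every $S\in\{S^1,S^2,S^3\}$. Let $\theta^*=(w^*,\tau_1^{*2},\tau_2^{*2})\in\Theta$ with $w^*\neq0$, and write $\bar\eta=1-\eta$. (1) If the true generating model is $(S^1,\theta^* )$, then as $N\to\infty$ $$\frac1N\log\left(\frac{1}{\pi(S^1\mid\mathcal{D}_{\mathrm{mix}})}-1\right)\xrightarrow{a.s.}-D_{12}(\eta),\qquad D_{12}(\eta):=\frac12\log\left(\frac{\eta\,\sigma_{1,X}^2+(1-\eta)\,\sigma_{1,Y}^2}{(\sigma_{1,X}^2)^{\eta}(\tau_1^{*2})^{\bar\eta}}\right),$$ where $\sigma_{1,X}^2:=w^{*2}\tau_2^{*2}+\tau_1^{*2}$ and $\sigma_{1,Y}^2:=w^{*2}y^2+\tau_1^{*2}$. (2) If the true generating model is $(S^2,\theta^* )$, then as $N\to\infty$ $$\frac1N\log\left(\frac{1}{\pi(S^2\mid\mathcal{D}_{\mathrm{mix}})}-1\right)\xrightarrow{a.s.}-D_{21}(\eta),\qquad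 D_{21}(\eta):=\frac12\log\left(1-\frac{\eta^2w^{*2}\tau_1^{*2}}{\eta\,\sigma_{2,Y}^2+\bar\eta\,y^2}\right)+\frac{\eta}{2}\log\left(\frac{\sigma_{2,Y}^2}{\tau_2^{*2}}\right),$$ where $\sigma_{2,Y}^2:=w^{*2}\tau_1^{*2}+\tau_2^{*2}$.
   Context: Models. Let $\Theta=\mathbb{R}\times(0,\infty)^2$ with elements $\theta=(w,\tau_1^2,\tau_2^2)$. Let $\epsilon=(\epsilon(1),\epsilon(2))$ be centered Gaussian with covariance $\mathrm{Diag}(\tau_1^2,\tau_2^2)$. For each structure $S$ and parameter $\theta$, an observational sample $X=(X(1),X(2))\in\mathbb{R}^2$ is distributed as follows: - $S^1$: $X(2)=\epsilon(2)$, $X(1)=wX(2)+\epsilon(1)$ (edge $X(2)\to X(1)$); - $S^2$: $X(1)=\epsilon(1)$, $X(2)=wX(1)+\epsilon(2)$ (edge $X(1)\to X(2)$); - $S^3$: $X(1)=\epsilon(1)$, $X(2)=\epsilon(2)$ (independence model; $w$ is fixed to $0$ and the only free parameters are $(\tau_1^2,\tau_2^2)\in(0,\infty)^2$). Interventional samples under $do(Y(2)=y)$ are $Y=(Y(1),y)$, where $Y(1)\sim N(wy,\tau_1^2)$ under $S^1$, and $Y(1)\sim N(0,\tau_1^2)$ under $S^2$ and under $S^3$. Likelihood. $f(\mathcal{D}_{\mathrm{mix}}\mid S,\theta)$ is the product of the Lebesgue densities of the $X_i$ and of the densities of the $Y_j(1)$ under $(S,\theta)$. Prior and posterior. The prior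 on structures is uniform, $\pi(S^j)=1/3$. Given $S$, the parameter has a prior probability density $\pi(\theta\mid S)$ on its parameter space ($\Theta$ for $S^1,S^2$; for $S^3$ a density on $(\tau_1^2,\tau_2^2)\in(0,\infty)^2$). Then $$\pi(S\mid\mathcal{D}_{\mathrm{mix}})=\frac{\int f(\mathcal{D}_{\mathrm{mix}}\mid S,\theta)\pi(\theta\mid S)\,d\theta}{\sum_{j=1}^3\int f(\mathcal{D}_{\mathrm{mix}}\mid S^j,\theta)\pi(\theta\mid S^j)\,d\theta},$$ each integral being over the parameter space of the corresponding structure. The data sets for different $N$ are initial segments of fixed infinite i.i.d. sequences $(X_i)_{i\ge1}$ and $(Y_i)_{i\ge1}$.
   Formalization: The formal theorem also assumes that the prior densities given S^1 and S^2 have full support (positive on a dense subset of Θ); without this the claim fails, e.g. for a smooth prior given S^1 that vanishes near θ*. *)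

(* Defs.v *)
From HB Require Import structures.
From mathcomp Require Import all_boot all_order all_algebra finmap.
From mathcomp Require Import all_classical all_reals all_analysis.
Set Implicit Arguments.
Unset Strict Implicit.
Unset Printing Implicit Defensive.
Import Order.TTheory GRing.Theory Num.Theory.
Import numFieldNormedType.Exports.
Local Open Scope classical_set_scope.
Local Open Scope ring_scope.

Inductive structure := S1 | S2 | S3.

Section Models.
Context {R : realType}.

(* Parameters and samples are tuples: th = (w, t1, t2) with t1, t2 the noise
   variances, and x = (x(1), x(2)).  The parameters of S3 are pairs (t1, t2),
   embedded as (0, t1, t2) when a likelihood is evaluated. *)
Definition Theta : set (R * R * R) := [set th | 0 < th.1.2 /\ 0 < th.2].
Definition Theta3 : set (R * R) := [set t | 0 < t.1 /\ 0 < t.2].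

(* The second argument of [normal_prob] and of [normal_pdf] is a standard
   deviation, hence the square roots below. *)
Definition noise_law (th : R * R * R) : set (R * R) -> \bar R :=
  let: (_, t1, t2) := th in
  (normal_prob 0 (Num.sqrt t1) \x normal_prob 0 (Num.sqrt t2))%E.

Definition structural_map (S : structure) (th : R * R * R) (e : R * R) :
    R * R :=
  let: (w, _, _) := th in
  match S with
  | S1 => (w * e.2 + e.1, e.2)
  | S2 => (e.1, w * e.1 + e.2)
  | S3 => e
  end.

Definition obs_law (S : structure) (th : R * R * R) : set (R * R) -> \bar R :=
  pushforward (noise_law th) (structural_map S th).

Definition do_mean (S : structure) (th : R * R * R) (y : R) : R :=
  if S is S1 then th.1.1 * y else 0.

Definition int_law (S : structure) (th : R * R * R) (y : R) :
    set (R * R) -> \bar R :=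
  pushforward (normal_prob (do_mean S th y) (Num.sqrt th.1.2))
              (fun v => (v, y)).

Definition obs_density (S : structure) (th : R * R * R) (x : R * R) : R :=
  let: (w, t1, t2) := th in
  match S with
  | S1 => normal_pdf (w * x.2) (Num.sqrt t1) x.1 *
          normal_pdf 0 (Num.sqrt t2) x.2
  | S2 => normal_pdf 0 (Num.sqrt t1) x.1 *
          normal_pdf (w * x.1) (Num.sqrt t2) x.2
  | S3 => normal_pdf 0 (Num.sqrt t1) x.1 * normal_pdf 0 (Num.sqrt t2) x.2
  end.

(* Density of the first coordinate of a sample under do(Y(2) = y). *)
Definition int_density (S : structure) (th : R * R * R) (y v : R) : R :=
  normal_pdf (do_mean S th y) (Num.sqrt th.1.2) v.

Definition likelihood (y : R) (n m : nat) (xs ys : nat -> R * R)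
    (S : structure) (th : R * R * R) : R :=
  (\prod_(i < n) obs_density S th (xs i)) *
  (\prod_(j < m) int_density S th y (ys j).1).

(* [lebesgue_measure] lives on [measurableTypeR R], a copy of R carrying the same
   Borel sets. *)
Definition leb2 :
    {measure
      set (measurableTypeR R * measurableTypeR R)%type -> \bar R} :=
  (@lebesgue_measure R \x @lebesgue_measure R)%E.
Definition leb3 :
    {measure
      set (measurableTypeR R * measurableTypeR R * measurableTypeR R)%type
        -> \bar R} :=
  (leb2 \x @lebesgue_measure R)%E.

Record priors := Priors {
  prior1 : R * R * R -> R;
  prior2 : R * R * R -> R;
  prior3 : R * R -> R }.

(* Real-valued integrals: an infinite marginal likelihood, which can only occur
   for small or degenerate data sets, is sent to 0. *)
Definition marginal (prior : priors) (y : R) (n m : nat)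
    (xs ys : nat -> R * R) (S : structure) : R :=
  match S with
  | S1 => \int[leb3]_(th in Theta)
            (likelihood y n m xs ys S1 th * prior1 prior th)
  | S2 => \int[leb3]_(th in Theta)
            (likelihood y n m xs ys S2 th * prior2 prior th)
  | S3 => \int[leb2]_(t in Theta3)
            (likelihood y n m xs ys S3 (0, t.1, t.2) * prior3 prior t)
  end.

(* The uniform prior 1/3 on structures cancels. *)
Definition posterior (prior : priors) (y : R) (n m : nat)
    (xs ys : nat -> R * R) (S : structure) : R :=
  let M := marginal prior y n m xs ys in M S / (M S1 + M S2 + M S3).

Definition D12 (y : R) (th : R * R * R) (eta : R) : R :=
  let: (w, t1, t2) := th in
  let s1X := w ^+ 2 * t2 + t1 in
  let s1Y := w ^+ 2 * y ^+ 2 + t1 in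
  2^-1 * ln ((eta * s1X + (1 - eta) * s1Y) /
             (s1X `^ eta * t1 `^ (1 - eta))).

Definition D21 (y : R) (th : R * R * R) (eta : R) : R :=
  let: (w, t1, t2) := th in
  let s2Y := w ^+ 2 * t1 + t2 in
  2^-1 * ln (1 - eta ^+ 2 * w ^+ 2 * t1 /
                 (eta * s2Y + (1 - eta) * y ^+ 2)) +
  eta / 2 * ln (s2Y / t2).

End Models.

Definition prior_density {R : realType} {d : measure_display}
    {V : measurableType d} (mu : {measure set V -> \bar R}) (D : set V)
    (p : V -> R) : Prop :=
  [/\ measurable_fun D p, forall v, D v -> 0 <= p v &
      (\int[mu]_(v in D) (p v)%:E)%E = 1%E].

(* Every nonempty relatively open subset of the open parameter space D meets
   {p > 0}: implied by, but weaker than, p > 0 everywhere on D.  A prior that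
   vanishes near the (pseudo-)true parameter changes the exponential rate of the
   marginal likelihood, whatever its smoothness. *)
Definition full_support {R : realType} {V : topologicalType} (D : set V)
    (p : V -> R) : Prop :=
  D `<=` closure (D `&` [set v | 0 < p v]).

(* k-fold Frechet differentiability on an open set U.  As V is meant to be
   finite dimensional, differentiability of the map v |-> 'd f v into the space
   of linear maps is tested on each direction h. *)
Fixpoint times_differentiable {R : realType} {V : normedModType R} (k : nat)
    (U : set V) (f : V -> R) : Prop :=
  if k is k'.+1 then
    (forall v, U v -> differentiable f v) /\
    (forall h, times_differentiable k' U (fun v => 'd f v h))
  else True.

Section Sampling.
Context {R : realType} {d : measure_display} {T : measurableType d}.
Variable P : probability T R.

Definition mutually_independent {I : choiceType} {d' : measure_display}
    {T' : measurableType d'} (Z : I -> {RV P >-> T'}) : Prop :=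
  forall (F : {fset I}) (A : I -> set T'), (forall i, measurable (A i)) ->
    P (\bigcap_(i in [set` F]) (Z i @^-1` A i)) =
    (\prod_(i <- F) P (Z i @^-1` A i))%E.

Definition sampling_model (S : structure) (th : R * R * R) (y : R)
    (X Y : nat -> {RV P >-> (R * R)%type}) : Prop :=
  [/\ forall i A, measurable A -> distribution P (X i) A = obs_law S th A,
      forall j A, measurable A -> distribution P (Y j) A = int_law S th y A &
      mutually_independent
        (fun k : nat + nat => match k with inl i => X i | inr j => Y j end)].

End Sampling.

(* Main.v *)
From HB Require Import structures.
Require Import Defs.
From mathcomp Require Import all_boot all_order all_algebra finmap.
From mathcomp Require Import all_classical all_reals all_analysis.
From mathcomp Require Import measurable_realfun.
From mathcomp Require Import ring lra.
Import Order.TTheory GRing.Theory Num.Theory.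
Import numFieldNormedType.Exports.
Local Open Scope classical_set_scope.
Local Open Scope ring_scope.
Set Implicit Arguments.
Unset Strict Implicit.
Unset Printing Implicit Defensive.

(** Posterior odds are ratios of marginal likelihoods, so the theorem compares
the exponential rates of the three marginals.  With N = n + m samples, the
log-likelihood divided by N has for every structure the shape
[[
  l(w, t1, t2) = - (ln (2 pi t1) + r ln (2 pi t2) + Q1(w) / t1 + Q2(w) / t2) / 2
]]
where r = n / N, and Q1, Q2 are quadratic polynomials in w whose coefficients
are empirical second moments (and the mean of the Y_j(1)).  Under S1 the weight
w only occurs in Q1, under S2 only in Q2, and S3 is the slice w = 0 of both.

If the coefficients converge, the marginal of S1 or S2 grows like
exp (N L), where L is the limit of the maximum of l ([marginal_exp_rate]).
From above, the marginal is at most the supremum of the likelihood, because the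
prior has total mass one; this supremum is explicit, as w is found by least
squares and then t1, t2 by the inequality ln z <= z - 1
([mean_loglik_le_profile]).  From below, l is jointly continuous in the
parameter and the coefficients, so it exceeds L - e on a neighbourhood of the
limiting maximiser, and the prior, continuous and of full support, charges that
neighbourhood ([prior_mass_gt0]).  The same upper bound on the slice w = 0 shows
that S3 never beats the false structure with a free weight, so that the odds
have the rate of the two-way comparison ([cvg_log_posterior_odds]).  The values
D12 and D21 are then differences of two explicit maxima ([profile_gap_D12],
[profile_gap_D21]).

The coefficients converge almost surely by a strong law of large numbers for
squares of affine forms in the samples; cross moments and means follow by
polarization.  Since the squares are non-negative and have finite variance, the
Chebyshev bounds along n = k^2 are summable, and the partial sums are monotone
in between ([strong_law_nonneg]).  The Gaussian moments this uses are read off from the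
expectation of exp (k (v + d)^2 / 2), a normalising constant of another Gaussian
density ([normal_mgf_sqr]). *)

(** * Second and fourth moments of Gaussian affine forms *)

Section density.
Context d (T : measurableType d) (R : realType).
Local Open Scope ereal_scope.

(** Any density agrees almost everywhere with the Radon-Nikodym derivative, for
which the change of variables is known. *)
Lemma ge0_integral_density (nu : {finite_measure set T -> \bar R})
    (mu : {sigma_finite_measure set T -> \bar R}) (g f : T -> \bar R) :
  mu.-integrable setT g ->
  (forall A, measurable A -> nu A = \int[mu]_(x in A) g x) ->
  measurable_fun setT f -> (forall x, 0 <= f x) ->
  \int[nu]_x f x = \int[mu]_x (f x * g x).
Proof.
move=> ig nuE mf f0.
have numu : nu `<< mu.
  apply/null_content_dominatesP => A mA muA; rewrite nuE//.
  by apply: null_set_integral => //; exact: measurable_funTS (measurable_int _ ig).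
rewrite -(Radon_Nikodym_SigmaFinite.change_of_variables numu)//.
have irn := Radon_Nikodym_SigmaFinite.f_integrable numu.
apply: ae_eq_integral => //.
- by apply: emeasurable_funM => //; exact: measurable_int irn.
- by apply: emeasurable_funM => //; exact: measurable_int ig.
- apply: ae_eqe_mul2l => /=; apply: integral_ae_eq => //=.
    exact: measurable_int ig.
  by move=> E _ mE; rewrite -nuE// -Radon_Nikodym_SigmaFinite.f_integral.
Qed.

End density.

Section normal_moments.
Context (R : realType).
Implicit Types m s v d : R.
Local Notation mu := (@lebesgue_measure R).

Lemma ge0_integral_normal_prob m s (f : measurableTypeR R -> \bar R) :
  measurable_fun setT f -> (forall x, (0 <= f x)%E) ->
  (\int[normal_prob m s]_x f x = \int[mu]_x (f x * (normal_pdf m s x)%:E))%E.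
Proof.
move=> mf f0; apply: ge0_integral_density => //.
exact: integrable_normal_pdf.
Qed.

(** Completing the square: multiplying a Gaussian density by the exponential of a
multiple of (v + d)^2 gives another Gaussian density up to a constant.  The
multiple is parametrised by the ratio rho of the two standard deviations, which
may be any positive number; rho = 1 is the untilted case. *)
Lemma normal_pdf_tilt m s d rho v : 0 < s -> 0 < rho ->
  expR ((1 - rho ^- 2) / s ^+ 2 * ((v + d) ^+ 2 / 2)) * normal_pdf m s v =
  rho * expR ((m + d) ^+ 2 / (2 * s ^+ 2) * (rho ^+ 2 - 1)) *
  normal_pdf ((m + d) * rho ^+ 2 - d) (rho * s) v.
Proof.
move=> s0 r0.
rewrite /normal_pdf !gt_eqF ?mulr_gt0// /normal_fun.
have -> : normal_peak s = rho * normal_peak (rho * s).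
  rewrite /normal_peak.
  have -> : (rho * s) ^+ 2 * pi *+ 2 = rho ^+ 2 * (s ^+ 2 * pi *+ 2) :> R by ring.
  rewrite sqrtrM ?sqr_ge0// sqrtr_sqr.
  by rewrite gtr0_norm// invfM mulrA divff ?mul1r ?gt_eqF.
set P := normal_peak _; set E1 := expR _; set E2 := expR _.
set E3 := expR _; set E4 := expR _.
suff : E1 * E2 = E3 * E4 by move=> H; ring: H.
rewrite /E1 /E2 /E3 /E4 -!expRD; congr expR.
field.
by rewrite !gt_eqF.
Qed.

Lemma normal_mgf_sqr m s d rho : 0 < s -> 0 < rho ->
  (\int[normal_prob m s]_v
      (expR ((1 - rho ^- 2) / s ^+ 2 * ((v + d) ^+ 2 / 2)))%:E =
   (rho * expR ((m + d) ^+ 2 / (2 * s ^+ 2) * (rho ^+ 2 - 1)))%:E)%E.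
Proof.
move=> s0 r0; rewrite ge0_integral_normal_prob; last 2 first.
- apply/measurable_EFinP; apply: measurableT_comp => //.
  apply: measurable_funM => //; apply: measurable_funM => //.
  by apply: measurable_funX; apply: measurable_funD.
- by move=> x; rewrite lee_fin expR_ge0.
under eq_integral do rewrite -EFinM normal_pdf_tilt// EFinM.
rewrite ge0_integralZl//=.
- by rewrite integral_normal_pdf mule1.
- by apply/measurable_EFinP; exact: measurable_normal_pdf.
- by move=> x _; rewrite lee_fin normal_pdf_ge0.
- by rewrite lee_fin mulr_ge0 ?expR_ge0// ltW.
Qed.


(** The inequality 1 + x <= exp x under the expectation.  For negative k both
sides are moved so that only integrals of non-negative functions occur. *)
Lemma expectation_expR_ge (disp : measure_display) (T : measurableType disp)
    (P : probability T R) (u : T -> R) (k q : R) :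
  measurable_fun setT u -> (forall x, 0 <= u x) ->
  (\int[P]_x (u x)%:E = q%:E)%E ->
  ((1 + k * q)%:E <= \int[P]_x (expR (k * u x))%:E)%E.
Proof.
move=> mu u0 uq.
have mku c : measurable_fun setT (fun x => (c * u x)%:E).
  by apply/measurable_EFinP; apply: measurable_funM.
have mexp : measurable_fun setT (fun x => (expR (k * u x))%:E).
  by apply/measurable_EFinP; apply: measurableT_comp => //; apply: measurable_funM.
have P1 : (\int[P]_x (1%:E : \bar R) = 1)%E.
  by rewrite integral_cst//= probability_setT mule1.
have kq c : 0 <= c -> (\int[P]_x (c * u x)%:E = (c * q)%:E)%E.
  move=> c0; under eq_integral do rewrite EFinM.
  rewrite ge0_integralZl//= ?uq//; first exact/measurable_EFinP.
  by move=> x _; rewrite lee_fin.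
have [k0|k0] := leP 0 k.
- rewrite EFinD -kq// -[X in (X + _)%E]P1 -ge0_integralD//=; last first.
    by move=> x _; rewrite lee_fin mulr_ge0.
  apply: ge0_le_integral => //=.
  + by move=> x _; rewrite -EFinD lee_fin addr_ge0// mulr_ge0.
  + by apply/measurable_EFinP; apply: measurable_funD => //; apply: measurable_funM.
  + by move=> x _; rewrite -EFinD lee_fin expR_ge1Dx.
- have Nk0 : 0 <= - k by rewrite oppr_ge0 ltW.
  have : (1 <= \int[P]_x (expR (k * u x))%:E + (- k * q)%:E)%E.
    rewrite -kq// -ge0_integralD//=; last first.
      by move=> x _; rewrite lee_fin mulr_ge0.
    rewrite -[leLHS]P1; apply: ge0_le_integral => //=.
    + by apply: emeasurable_funD => //; exact: mku.
    + move=> x _; rewrite -EFinD lee_fin.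
      have := expR_ge1Dx (k * u x); lra.
  rewrite -leeBlDr// -EFinB.
  by have -> : 1 - - k * q = 1 + k * q by ring.
Qed.

(** The exponential moment of [normal_mgf_sqr] at rho = 2 dominates every
polynomial in v. *)
Lemma normal_lty_expR_sqr m s d C (f : measurableTypeR R -> R) :
  0 < s -> measurable_fun setT f -> (forall v, 0 <= f v) ->
  (forall v, f v <= C * expR ((1 - 2 ^- 2) / s ^+ 2 * ((v + d) ^+ 2 / 2))) ->
  (\int[normal_prob m s]_v (f v)%:E < +oo)%E.
Proof.
move=> s0 mf f0 fC.
have C0 : 0 <= C.
  by have := le_trans (f0 0) (fC 0); rewrite pmulr_lge0 ?expR_gt0.
have mexp : measurable_fun [set: R] (fun v : measurableTypeR R =>
    (expR ((1 - 2 ^- 2) / s ^+ 2 * ((v + d) ^+ 2 / 2)))%:E).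
  apply/measurable_EFinP; apply: measurableT_comp => //.
  apply: measurable_funM => //; apply: measurable_funM => //.
  by apply: measurable_funX; apply: measurable_funD.
apply: (@le_lt_trans _ _ (\int[normal_prob m s]_v
    (C%:E * (expR ((1 - 2 ^- 2) / s ^+ 2 * ((v + d) ^+ 2 / 2)))%:E))%E).
  apply: ge0_le_integral => //=.
  - by move=> v _; rewrite lee_fin.
  - exact/measurable_EFinP.
  - exact: emeasurable_funM.
  - by move=> v _; rewrite -EFinM lee_fin.
by rewrite ge0_integralZl//= normal_mgf_sqr// -EFinM ltry.
Qed.

Lemma normal_sqr_lty m s d : 0 < s ->
  (\int[normal_prob m s]_v ((v + d) ^+ 2 / 2)%:E < +oo)%E.
Proof.
move=> s0.
have k0 : 0 < (1 - 2 ^- 2) / s ^+ 2 :> R.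
  by rewrite divr_gt0 ?exprn_gt0// subr_gt0 invf_lt1 ?exprn_gt0//; lra.
apply: (@normal_lty_expR_sqr m s d ((1 - 2 ^- 2) / s ^+ 2)^-1) => //.
- by apply: measurable_funM => //; apply: measurable_funX; apply: measurable_funD.
- by move=> v; rewrite divr_ge0 ?sqr_ge0.
- move=> v; rewrite ler_pdivlMl//.
  by have := expR_ge1Dx ((1 - 2 ^- 2) / s ^+ 2 * ((v + d) ^+ 2 / 2)); lra.
Qed.

Lemma normal_pow4_lty m s d : 0 < s ->
  (\int[normal_prob m s]_v ((v + d) ^+ 4)%:E < +oo)%E.
Proof.
move=> s0.
have k0 : 0 < (1 - 2 ^- 2) / s ^+ 2 :> R.
  by rewrite divr_gt0 ?exprn_gt0// subr_gt0 invf_lt1 ?exprn_gt0//; lra.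
set k := _ / _ in k0.
apply: (@normal_lty_expR_sqr m s d (16 / k ^+ 2)) => //.
- by apply: measurable_funX; apply: measurable_funD.
- by move=> v; rewrite exprn_even_ge0.
- move=> v; rewrite -/k mulrAC ler_pdivlMr ?exprn_gt0//.
  set u := (v + d) ^+ 2 / 2.
  have u0 : 0 <= k * u / 2.
    apply: divr_ge0 => //; apply: mulr_ge0; first exact: ltW.
    by apply: divr_ge0 => //; exact: sqr_ge0.
  (* Squaring 1 + z <= exp z at z = k u / 2 controls u^2, a fourth power. *)
  have -> : expR (k * u) = expR (k * u / 2) ^+ 2.
    by rewrite -expRM_natl; congr expR; field.
  have -> : (v + d) ^+ 4 * k ^+ 2 = 16 * (k * u / 2) ^+ 2 by rewrite /u; field.
  rewrite ler_pM2l// ler_sqr ?nnegrE ?expR_ge0//.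
  by have := expR_ge1Dx (k * u / 2); lra.
Qed.

(** The two sides of the hypothesis agree at rho = 1, so that rho = 1 minimises
their difference, whose derivative therefore vanishes there. *)
Lemma tangent_at_one (A q : R) :
  (forall rho, 0 < rho -> 1 + (1 - rho ^- 2) * q <=
                          rho * expR (A * (rho ^+ 2 - 1))) ->
  2 * q = 1 + 2 * A.
Proof.
move=> H.
pose g := (fun rho : R => rho * expR (A * (rho ^+ 2 - 1)) + rho ^- 2 * q).
have dg (x : R) : 0 < x -> is_derive x 1 g
   (x * (expR (A * (x ^+ 2 - 1)) * (A * (2 * x))) + expR (A * (x ^+ 2 - 1))
    - 2 * x ^- 3 * q).
  move=> x0; have xn0 : x != 0 by rewrite gt_eqF.
  have xn2 : x ^+ 2 != 0 by rewrite expf_neq0.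
  have d1 : is_derive x (1:R) (fun rho : R => rho ^- 2) (- 2 * x ^- 3).
    by apply: is_derive_eq; rewrite /GRing.scale/=; field.
  have d2 : is_derive x (1:R) (fun rho : R => expR (A * (rho ^+ 2 - 1)))
      (expR (A * (x ^+ 2 - 1)) * (A * (2 * x))).
    apply: (@is_derive1_comp _ expR (fun rho => A * (rho ^+ 2 - 1))).
    by apply: is_derive_eq; rewrite /GRing.scale/=; ring.
  by apply: is_derive_eq; rewrite /GRing.scale/=; ring.
have : is_derive (1 : R) 1 g 0.
  apply: (@derive1_at_min _ _ (2^-1) 2).
  - by lra.
  - move=> t; rewrite in_itv/= => /andP[t0 _].
    have t1 : 0 < t by lra.
    by have [] := dg t t1.
  - by rewrite in_itv/=; lra.
  - move=> t; rewrite in_itv/= => /andP[t0 _].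
    have t1 : 0 < t by lra.
    by have := H t t1; rewrite /g expr1n subrr mulr0 expR0 invr1; lra.
move=> /@derive_val; have /@derive_val -> := dg 1 ltr01.
by rewrite expr1n subrr mulr0 expR0 expr1n invr1; lra.
Qed.

(** The lower bound [expectation_expR_ge] and the exact value [normal_mgf_sqr]
touch at rho = 1; equality of the slopes gives the second moment. *)
Lemma normal_sqr_moment m s d : 0 < s ->
  (\int[normal_prob m s]_v ((v + d) ^+ 2)%:E = (s ^+ 2 + (m + d) ^+ 2)%:E)%E.
Proof.
move=> s0; have lty := @normal_sqr_lty m s d s0.
have mq : measurable_fun [set: R] (fun v : measurableTypeR R => (v + d) ^+ 2 / 2).
  by apply: measurable_funM => //; apply: measurable_funX; apply: measurable_funD.
have q0 v : 0 <= (v + d) ^+ 2 / 2 by rewrite divr_ge0 ?sqr_ge0.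
have ge0 : (0 <= \int[normal_prob m s]_v ((v + d) ^+ 2 / 2)%:E)%E.
  by apply: integral_ge0 => v _; rewrite lee_fin.
move: lty; rewrite -ge0_fin_numE// => /fineK; set q := fine _ => /esym qE.
under eq_integral => v _.
  rewrite (_ : (v + d) ^+ 2 = 2 * ((v + d) ^+ 2 / 2)); last by field.
  rewrite EFinM; over.
rewrite ge0_integralZl//=; last 2 first.
- exact/measurable_EFinP.
- by move=> v _; rewrite lee_fin.
rewrite qE -EFinM; congr EFin.
have /tangent_at_one : forall rho, 0 < rho -> 1 + (1 - rho ^- 2) * (q / s ^+ 2) <=
   rho * expR ((m + d) ^+ 2 / (2 * s ^+ 2) * (rho ^+ 2 - 1)).
  move=> rho rho0; rewrite -lee_fin -normal_mgf_sqr//.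
  rewrite [X in 1 + X](_ : _ = (1 - rho ^- 2) / s ^+ 2 * q); last by ring.
  exact: expectation_expR_ge.
move=> /(congr1 (fun z => z * s ^+ 2)).
have -> : 2 * (q / s ^+ 2) * s ^+ 2 = 2 * q by field; rewrite gt_eqF.
by move=> ->; field; rewrite gt_eqF.
Qed.

Lemma normal_affine_sqr_moment m s a c : 0 < s ->
  (\int[normal_prob m s]_v ((a * v + c) ^+ 2)%:E =
   (a ^+ 2 * s ^+ 2 + (a * m + c) ^+ 2)%:E)%E.
Proof.
move=> s0; have [->|a0] := eqVneq a 0.
  under eq_integral do rewrite mul0r add0r.
  by rewrite integral_cst//= probability_setT mule1 expr0n/= !mul0r !add0r.
under eq_integral => v _.
  rewrite (_ : a * v + c = a * (v + c / a)); last by field.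
  rewrite exprMn EFinM; over.
rewrite ge0_integralZl//=.
- by rewrite normal_sqr_moment// -EFinM; congr EFin; field.
- apply/measurable_EFinP.
  by apply: measurable_funX; apply: measurable_funD.
- by move=> v _; rewrite lee_fin sqr_ge0.
- by rewrite lee_fin sqr_ge0.
Qed.

Lemma normal_affine_pow4_lty m s a c : 0 < s ->
  (\int[normal_prob m s]_v ((a * v + c) ^+ 4)%:E < +oo)%E.
Proof.
move=> s0; have [->|a0] := eqVneq a 0.
  under eq_integral do rewrite mul0r add0r.
  by rewrite integral_cst//= probability_setT mule1 ltry.
under eq_integral => v _.
  rewrite (_ : a * v + c = a * (v + c / a)); last by field.
  rewrite exprMn EFinM; over.
rewrite ge0_integralZl//=.
- rewrite lte_mul_pinfty ?lee_fin ?exprn_even_ge0//.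
  exact: normal_pow4_lty.
- apply/measurable_EFinP.
  by apply: measurable_funX; apply: measurable_funD.
- by move=> v _; rewrite lee_fin exprn_even_ge0.
- by rewrite lee_fin exprn_even_ge0.
Qed.

End normal_moments.

Section normal_product_moments.
Context (R : realType) (m1 m2 s1 s2 : R) (s1_gt0 : 0 < s1) (s2_gt0 : 0 < s2).
Implicit Types a b c : R.
Local Notation nu := (normal_prob m1 s1 \x normal_prob m2 s2)%E.

Lemma measurable_affine_pair a b c :
  measurable_fun setT
    (fun e : measurableTypeR R * measurableTypeR R => a * e.1 + b * e.2 + c).
Proof.
by apply: measurable_funD => //; apply: measurable_funD => //;
  apply: measurable_funM => //.
Qed.

Lemma normal_pair_sqr_moment a b c :
  (\int[nu]_e ((a * e.1 + b * e.2 + c) ^+ 2)%:E =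
   (a ^+ 2 * s1 ^+ 2 + b ^+ 2 * s2 ^+ 2 + (a * m1 + b * m2 + c) ^+ 2)%:E)%E.
Proof.
rewrite fubini_tonelli1/=; last 2 first.
- by apply/measurable_EFinP; apply: measurable_funX; exact: measurable_affine_pair.
- by move=> e; rewrite lee_fin sqr_ge0.
rewrite /fubini_F/=.
have inner x : (\int[normal_prob m2 s2]_z ((a * x + b * z + c) ^+ 2)%:E =
    (b ^+ 2 * s2 ^+ 2)%:E + ((a * x + (b * m2 + c)) ^+ 2)%:E)%E.
  under eq_integral do rewrite addrAC addrC.
  rewrite normal_affine_sqr_moment// EFinD; congr (_ + (_ ^+ 2)%:E)%E; ring.
under eq_integral do rewrite inner.
rewrite ge0_integralD//=.
- rewrite integral_cst//= probability_setT mule1 normal_affine_sqr_moment//.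
  by rewrite -EFinD; congr EFin; ring.
- by move=> x _; rewrite lee_fin mulr_ge0 ?sqr_ge0.
- by move=> x _; rewrite lee_fin sqr_ge0.
- by apply/measurable_EFinP; apply: measurable_funX; apply: measurable_funD.
Qed.

Lemma normal_pair_pow4_lty a b c :
  (\int[nu]_e ((a * e.1 + b * e.2 + c) ^+ 4)%:E < +oo)%E.
Proof.
have mpow (p q r : R) : measurable_fun setT
    (fun e : measurableTypeR R * measurableTypeR R =>
       (8 * (p * e.1 + q * e.2 + r) ^+ 4)%:E).
  apply/measurable_EFinP; apply: measurable_funM => //.
  by apply: measurable_funX; exact: measurable_affine_pair.
have mpow1 (p q : R) : measurable_fun setT
    (fun v : measurableTypeR R => ((p * v + q) ^+ 4)%:E).
  apply/measurable_EFinP; apply: measurable_funX.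
  by apply: measurable_funD => //; apply: measurable_funM.
have ge0 (p q r : R) (e : measurableTypeR R * measurableTypeR R) :
    (0 <= (8 * (p * e.1 + q * e.2 + r) ^+ 4)%:E)%E.
  by rewrite lee_fin mulr_ge0 ?exprn_even_ge0.
apply: (@le_lt_trans _ _ (\int[nu]_e
    ((8 * (a * e.1 + 0 * e.2 + 0) ^+ 4)%:E +
     (8 * (0 * e.1 + b * e.2 + c) ^+ 4)%:E))%E).
  apply: ge0_le_integral => //=.
  - by move=> e _; rewrite lee_fin exprn_even_ge0.
  - by apply/measurable_EFinP; apply: measurable_funX; exact: measurable_affine_pair.
  - by apply: emeasurable_funD; exact: mpow.
  - move=> e _; rewrite -EFinD lee_fin !mul0r add0r !addr0 -[_ + _ + c]addrA.
    move: (a * e.1) (b * e.2 + c) => p q.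
    (* The gap in (p + q)^4 <= 8 (p^4 + q^4), factored. *)
    have -> : 8 * p ^+ 4 + 8 * q ^+ 4 = (p + q) ^+ 4 +
        (p - q) ^+ 2 * (7 * p ^+ 2 + 10 * (p * q) + 7 * q ^+ 2) by ring.
    rewrite lerDl mulr_ge0 ?sqr_ge0//.
    by have := sqr_ge0 (p + q); have := sqr_ge0 p; have := sqr_ge0 q; nra.
rewrite ge0_integralD//= lte_add_pinfty//.
- rewrite fubini_tonelli1// /fubini_F/=.
  under eq_integral do under eq_integral do rewrite mul0r addr0.
  under eq_integral do rewrite integral_cst//= probability_setT mule1 EFinM.
  rewrite ge0_integralZl//=; last by move=> x _; rewrite lee_fin exprn_even_ge0.
  by rewrite lte_mul_pinfty// normal_affine_pow4_lty.
- rewrite fubini_tonelli1// /fubini_F/=.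
  have inner x : (\int[normal_prob m2 s2]_z (8 * (0 * x + b * z + c) ^+ 4)%:E =
      8%:E * \int[normal_prob m2 s2]_z ((b * z + c) ^+ 4)%:E)%E.
    under eq_integral do rewrite mul0r add0r EFinM.
    by rewrite ge0_integralZl//= => v _; rewrite lee_fin exprn_even_ge0.
  under eq_integral do rewrite inner.
  have : (8%:E * \int[normal_prob m2 s2]_z ((b * z + c) ^+ 4)%:E < +oo)%E.
    by rewrite lte_mul_pinfty// normal_affine_pow4_lty.
  move: (_ * _)%E => K Koo.
  by rewrite integral_cst//= probability_setT mule1.
Qed.

End normal_product_moments.

(** * A strong law for non-negative variables *)

Section nonneg_averages.
Context (R : realType).

Lemma isqrt_seq : {k : nat -> nat |
  (forall n, (k n ^ 2 <= n < (k n).+1 ^ 2)%N) & k @ \oo --> \oo}.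
Proof.
have /choice[k kP] : forall n, exists k, (k ^ 2 <= n < k.+1 ^ 2)%N.
  elim=> [|n [k /andP[kn nk]]]; first by exists 0%N.
  have [nk1|nk1] := ltnP n.+1 (k.+1 ^ 2)%N.
    by exists k; rewrite nk1 (leq_trans kn).
  exists k.+1; rewrite nk1/= (leq_trans (n := (k.+1 ^ 2).+1))//.
  by rewrite ltn_sqr.
exists k => //; apply/cvgnyPge => A; near=> n.
have /andP[_ nk] := kP n.
rewrite -ltnS -ltn_sqr (leq_ltn_trans _ nk)//.
by near: n; exact: nbhs_infty_ge.
Unshelve. all: by end_near. Qed.

(** Partial sums of a non-negative sequence are monotone, so the average at n is
caught between those at the two nearest squares, up to factors
(k / (k + 1))^2 and its inverse. *)
Lemma cvg_average_squares (U : nat -> R) (l : R) : (forall i, 0 <= U i) ->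
  (fun k => (\sum_(i < k.+1 ^ 2) U i) / (k.+1 ^ 2)%:R) @ \oo --> l ->
  (fun n => (\sum_(i < n) U i) / n%:R) @ \oo --> l.
Proof.
move=> U0 H; pose S n := \sum_(i < n) U i.
pose A (k : nat) := S (k ^ 2)%N / (k ^ 2)%:R.
have Al : A @ \oo --> l by rewrite -(cvg_shiftS A).
have [k kP ky] := isqrt_seq.
have S0 a : 0 <= S a by rewrite sumr_ge0.
have Smono (a b : nat) : (a <= b)%N -> S a <= S b.
  have := @nondecreasing_series _ U xpredT 0 (fun n _ _ => U0 n).
  by move=> /[apply]; rewrite !big_mkord.
pose g (k : nat) : R := k%:R / k.+1%:R.
have g1 : g @ \oo --> (1:R).
  have -> : g = (fun k => 1 - harmonic k).
    by apply/funext => j; rewrite /g/= -natr1; field; rewrite natr1 pnatr_eq0.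
  rewrite -[X in _ --> X]subr0; apply: cvgB; [exact: cvg_cst|exact: cvg_harmonic].
have gk1 : (fun n => g (k n) ^+ 2) @ \oo --> (1:R).
  rewrite -[X in _ --> X](expr1n _ 2); apply: cvgM; exact: (cvg_comp k g ky g1).
apply: (@squeeze_cvgr _ _ _ _ (fun n => A (k n) * g (k n) ^+ 2)
                              (fun n => A (k n).+1 / g (k n) ^+ 2)).
- near=> n.
  have /andP[kn nk] := kP n.
  have k0 : (0 < k n)%N.
    by near: n; move/cvgnyPge : ky; apply.
  have n0 : (0 < n)%N by rewrite (leq_trans _ kn)// expn_gt0 k0.
  have -> : A (k n) * g (k n) ^+ 2 = S (k n ^ 2)%N / ((k n).+1 ^ 2)%:R.
    rewrite /A /g !natrX -natr1; field.
    by rewrite natr1 !pnatr_eq0 -!lt0n k0.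
  have -> : A (k n).+1 / g (k n) ^+ 2 = S ((k n).+1 ^ 2)%N / (k n ^ 2)%:R.
    rewrite /A /g !natrX -natr1; field.
    by rewrite natr1 !pnatr_eq0 -!lt0n k0.
  apply/andP; split; apply: ler_pM => //.
  + exact: Smono.
  + by rewrite lef_pV2 ?posrE ?ltr0n ?expn_gt0// ler_nat ltnW.
  + exact: S0.
  + by apply: Smono; exact: ltnW.
  + by rewrite lef_pV2 ?posrE ?ltr0n ?expn_gt0 ?k0// ler_nat.
- rewrite -[X in _ --> X]mulr1; apply: cvgM => //; exact: (cvg_comp k A ky Al).
- have -> : l = l * 1^-1 by rewrite invr1 mulr1.
  apply: cvgM.
    by apply: (cvg_comp k (fun j => A j.+1) ky); rewrite (cvg_shiftS A).
  by apply: cvgV => //; exact: oner_neq0.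
Unshelve. all: by end_near. Qed.

End nonneg_averages.

Section strong_law.
Context d (T : measurableType d) (R : realType) (P : probability T R).
Variables (U : nat -> T -> R) (mean q : R).
Hypothesis mU : forall i, measurable_fun setT (U i).
Hypothesis U0 : forall i x, 0 <= U i x.
Hypothesis EU : forall i, (\int[P]_x (U i x)%:E = mean%:E)%E.
Hypothesis EU2 : forall i, (\int[P]_x (U i x ^+ 2)%:E <= q%:E)%E.
Hypothesis EUU : forall i j, i != j ->
  (\int[P]_x (U i x * U j x)%:E = (mean ^+ 2)%:E)%E.

Let S n x := \sum_(i < n) U i x.

Let mS n : measurable_fun setT (S n).
Proof. exact: measurable_sum. Qed.

Let S0 n x : 0 <= S n x. Proof. by rewrite sumr_ge0. Qed.

Let mean0 : 0 <= mean.
Proof. by rewrite -lee_fin -(EU 0); apply: integral_ge0 => x _; rewrite lee_fin. Qed.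

Let q0 : 0 <= q.
Proof.
rewrite -lee_fin; apply: le_trans (EU2 0).
by apply: integral_ge0 => x _; rewrite lee_fin sqr_ge0.
Qed.

Let ES n : (\int[P]_x (S n x)%:E = (n%:R * mean)%:E)%E.
Proof.
under eq_integral do rewrite -sumEFin.
rewrite ge0_integral_sum//; last first.
- by move=> i x _; rewrite lee_fin.
- by move=> i; exact/measurable_EFinP.
under eq_bigr do rewrite EU.
by rewrite sumEFin sumr_const card_ord mulr_natl.
Qed.

Let ES2 n : (\int[P]_x (S n x ^+ 2)%:E <= (n%:R * q + n%:R ^+ 2 * mean ^+ 2)%:E)%E.
Proof.
have mUU i j : measurable_fun setT (fun x => (U i x * U j x)%:E).
  by apply/measurable_EFinP; exact: measurable_funM.
under eq_integral do rewrite expr2 big_distrlr/= -sumEFin.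
rewrite ge0_integral_sum//; last first.
- by move=> i x _; rewrite lee_fin sumr_ge0// => j _; rewrite mulr_ge0.
- move=> i; apply/measurable_EFinP; apply: measurable_sum => j.
  exact: measurable_funM.
apply: (@le_trans _ _ (\sum_(i < n) (q + n%:R * mean ^+ 2)%:E)%E); last first.
  by rewrite sumEFin sumr_const card_ord lee_fin -[leLHS]mulr_natl mulrDr mulrA expr2.
apply: lee_sum => i _.
under eq_integral do rewrite -sumEFin.
rewrite ge0_integral_sum//; last by move=> j x _; rewrite lee_fin mulr_ge0.
rewrite (bigD1 i)//= EFinD; apply: leeD.
  by under eq_integral do rewrite -expr2; exact: EU2.
apply: (@le_trans _ _ (\sum_(j < n) (mean ^+ 2)%:E)%E).
  rewrite [leRHS](bigD1 i)//=; apply: le_trans (leeDr _ _).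
    by apply: lee_sum => j ji; rewrite EUU// eq_sym.
  by rewrite lee_fin sqr_ge0.
by rewrite sumEFin sumr_const card_ord lee_fin mulr_natl.
Qed.

(** Chebyshev's bound on the variance of the sum, obtained from
(S - n mean)^2 + 2 n mean S = S^2 + (n mean)^2, where all terms are
non-negative. *)
Let var_bound n : (\int[P]_x ((S n x - n%:R * mean) ^+ 2)%:E <= (n%:R * q)%:E)%E.
Proof.
have m1 : measurable_fun setT (fun x => (S n x - n%:R * mean) ^+ 2).
  by apply: measurable_funX; exact: measurable_funB.
have c0 : 0 <= 2 * (n%:R * mean) by rewrite !mulr_ge0.
have : (\int[P]_x (((S n x - n%:R * mean) ^+ 2)%:E + (2 * (n%:R * mean) * S n x)%:E) =
        \int[P]_x ((S n x ^+ 2)%:E + ((n%:R * mean) ^+ 2)%:E))%E.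
  by apply: eq_integral => x _; rewrite -!EFinD; congr EFin; ring.
rewrite ge0_integralD//=; last 4 first.
- by move=> x _; rewrite lee_fin sqr_ge0.
- exact/measurable_EFinP.
- by move=> x _; rewrite lee_fin mulr_ge0.
- by apply/measurable_EFinP; exact: measurable_funM.
rewrite ge0_integralD//=; last 3 first.
- by move=> x _; rewrite lee_fin sqr_ge0.
- by apply/measurable_EFinP; exact: measurable_funX.
- by move=> x _; rewrite lee_fin sqr_ge0.
under [X in (_ + X = _)%E -> _]eq_integral do rewrite EFinM.
rewrite ge0_integralZl//=; last 2 first.
- exact/measurable_EFinP.
- by move=> x _; rewrite lee_fin.
rewrite ES integral_cst//= probability_setT mule1 -EFinM => E1.
rewrite -(@leeD2rE _ (2 * (n%:R * mean) * (n%:R * mean))%:E)// E1.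
apply: le_trans (leeD (ES2 n) (lexx _)) _.
by rewrite -!EFinD lee_fin; lra.
Qed.

(** The expected squared errors along n = (k + 1)^2 are summable; hence the sum
of the squared errors is almost surely finite and the errors tend to 0.
Monotonicity of the partial sums extends this to all n. *)
Lemma strong_law_nonneg : {ae P, forall x,
  (fun n => (\sum_(i < n) U i x) / n%:R) @ \oo --> mean}.
Proof.
pose V k x := (S (k.+1 ^ 2) x / (k.+1 ^ 2)%:R - mean) ^+ 2.
have mV k : measurable_fun setT (V k).
  apply: measurable_funX; apply: measurable_funB => //; exact: measurable_funM.
have V0 k x : 0 <= V k x by rewrite sqr_ge0.
have EV k : (\int[P]_x (V k x)%:E <= (q / (k.+1 ^ 2)%:R)%:E)%E.
  set N := (k.+1 ^ 2)%N; have N0 : 0 < N%:R :> R by rewrite ltr0n expn_gt0.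
  have -> : (\int[P]_x (V k x)%:E =
      (N%:R ^- 2)%:E * \int[P]_x ((S N x - N%:R * mean) ^+ 2)%:E)%E.
    rewrite -ge0_integralZl//=.
    + apply: eq_integral => x _; rewrite -EFinM; congr EFin.
      by rewrite /V -/N; field; rewrite gt_eqF.
    + by apply/measurable_EFinP; apply: measurable_funX; exact: measurable_funB.
    + by move=> x _; rewrite lee_fin sqr_ge0.
  apply: le_trans (lee_wpmul2l _ (var_bound N)) _.
    by rewrite lee_fin invr_ge0 sqr_ge0.
  rewrite -EFinM lee_fin le_eqVlt; apply/orP; left; apply/eqP.
  by field; rewrite gt_eqF.
have sumEV : (\sum_(k <oo) \int[P]_x (V k x)%:E < +oo)%E.
  apply: (@le_lt_trans _ _ (2 * q)%:E); last exact: ltry.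
  apply: lime_le.
    by apply: is_cvg_ereal_nneg_natsum => k _; apply: integral_ge0 => x _; rewrite lee_fin.
  apply: nearW => n.
  (* Telescoping majorant: 1 / (n + 1)^2 <= 2 / (n + 1) - 2 / (n + 2). *)
  apply: (@le_trans _ _ (2 * q - 2 * q / n.+1%:R)%:E); last first.
    by rewrite lee_fin lerBlDr lerDl divr_ge0 ?mulr_ge0.
  elim: n => [|n IH]; first by rewrite big_nil divr1 subrr.
  rewrite big_nat_recr//=; apply: le_trans (leeD IH (EV n)) _.
  rewrite -EFinD lee_fin natrX -(natr1 n.+1).
  have : 1 <= n.+1%:R :> R by rewrite ler1n.
  move: (n.+1%:R) => z z1.
  rewrite -subr_ge0.
  have -> : 2 * q - 2 * q / (z + 1) - (2 * q - 2 * q / z + q / z ^+ 2) =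
            q * (z - 1) / (z ^+ 2 * (z + 1)).
    by field; rewrite !gt_eqF//; lra.
  by rewrite divr_ge0 ?mulr_ge0 ?sqr_ge0//; lra.
have mVE k : measurable_fun setT (EFin \o V k) by exact/measurable_EFinP.
have : P.-integrable setT (fun x => \sum_(k <oo) (V k x)%:E)%E.
  apply/integrableP; split.
    apply: (@ge0_emeasurable_sum _ _ _ _ (fun k x => (V k x)%:E) xpredT).
      by move=> k x _ _; rewrite lee_fin.
    by move=> k _; exact: mVE.
  rewrite (eq_integral (fun x => \sum_(k <oo) (V k x)%:E)%E); last first.
    by move=> x _; rewrite gee0_abs//; apply: nneseries_ge0 => k _ _; rewrite lee_fin.
  by rewrite integral_nneseries// => k x _; rewrite lee_fin.
move=> /integrable_ae => /(_ measurableT); apply: filterS => x /(_ I) Vfin.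
have VE : (fun k => V k x) @ \oo --> (0:R).
  apply: cvg_series_cvg_0; apply: nondecreasing_is_cvgn.
    exact: nondecreasing_series.
  exists (fine (\sum_(k <oo) (V k x)%:E)%E) => _ [n _ <-].
  rewrite -lee_fin fineK// /series/= -sumEFin.
  by apply: nneseries_lim_ge => k _ _; rewrite lee_fin.
apply: (@cvg_average_squares _ (fun i => U i x)) => //.
suff : (fun k => S (k.+1 ^ 2) x / (k.+1 ^ 2)%:R - mean) @ \oo --> (0:R).
  by move=> /subr_cvg0.
apply/norm_cvg0P.
have -> : (fun k => `|S (k.+1 ^ 2) x / (k.+1 ^ 2)%:R - mean|) =
          (fun k => Num.sqrt (V k x)).
  by apply/funext => k; rewrite sqrtr_sqr.
rewrite -[X in _ --> X](@sqrtr0 R).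
exact: (cvg_comp (fun k => V k x) _ VE (@sqrt_continuous _ _)).
Qed.

End strong_law.

(** * Laws, independence and sample averages *)

Section independence.
Context d (T : measurableType d) (R : realType) (P : probability T R).
Local Open Scope ereal_scope.

Lemma ge0_integral_law d1 d2 (E : measurableType d1) (V : measurableType d2)
    (nu : {measure set E -> \bar R}) (phi : E -> V) (Z : {RV P >-> V})
    (f : V -> \bar R) :
  measurable_fun setT phi ->
  (forall A, measurable A -> distribution P Z A = pushforward nu phi A) ->
  measurable_fun setT f -> (forall v, 0 <= f v) ->
  \int[P]_x f (Z x) = \int[nu]_e f (phi e).
Proof.
move=> mphi lawZ mf f0.
pose phi' : {mfun E >-> V} := HB.pack phi (isMeasurableFun.Build _ _ _ _ _ mphi).
rewrite -[LHS](ge0_integral_distribution Z mf f0).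
rewrite (@eq_measure_integral _ _ _ _ (pushforward nu phi')).
  by rewrite ge0_integral_pushforward.
by move=> A mA _; exact: lawZ.
Qed.

(** Independence makes the joint law a product measure, by uniqueness of the
latter on rectangles; Tonelli's theorem factors the integral. *)
Lemma ge0_integral_indep d1 (V : measurableType d1) (Z1 Z2 : {RV P >-> V})
    (f g : V -> \bar R) :
  (forall A B, measurable A -> measurable B ->
     P (Z1 @^-1` A `&` Z2 @^-1` B) = P (Z1 @^-1` A) * P (Z2 @^-1` B)) ->
  measurable_fun setT f -> (forall v, 0 <= f v) ->
  measurable_fun setT g -> (forall v, 0 <= g v) ->
  \int[P]_x (f (Z1 x) * g (Z2 x)) = (\int[P]_x f (Z1 x)) * (\int[P]_x g (Z2 x)).
Proof.
move=> indep mf f0 mg g0.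
have mZ : measurable_fun setT (fun x => (Z1 x, Z2 x)).
  by apply/measurable_fun_pairP; split => /=; exact: measurable_funP.
pose Z : {mfun T >-> (V * V)%type} :=
  HB.pack (fun x => (Z1 x, Z2 x)) (isMeasurableFun.Build _ _ _ _ _ mZ).
have mfg : measurable_fun [set: V * V] (fun z => f z.1 * g z.2).
  by apply: emeasurable_funM; exact: measurableT_comp.
have fg0 (z : V * V) : 0 <= f z.1 * g z.2 by rewrite mule_ge0.
rewrite -[LHS](@ge0_integral_distribution _ _ _ _ _ P Z (fun z => f z.1 * g z.2))//.
rewrite (@eq_measure_integral _ _ _ _ (distribution P Z1 \x distribution P Z2)); last first.
  move=> A mA _; apply/esym; apply: product_measure_unique => // B C mB mC.
rewrite fubini_tonelli1// /fubini_F/=.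
have Eg0 : 0 <= \int[P]_x g (Z2 x) by apply: integral_ge0.
have inner v : \int[distribution P Z2]_z (f v * g z) =
    (\int[P]_x g (Z2 x)) * f v.
  by rewrite ge0_integralZl// muleC (ge0_integral_distribution Z2 mg g0).
under eq_integral do rewrite inner.
rewrite ge0_integralZl// muleC; congr (_ * _).
exact: (ge0_integral_distribution Z1 mf f0).
Qed.

Lemma strong_law_iid d1 (V : measurableType d1) (Z : nat -> {RV P >-> V})
    (g : V -> R) (mean q : R) :
  measurable_fun setT g -> (forall v, (0 <= g v)%R) ->
  (forall i, \int[P]_x (g (Z i x))%:E = mean%:E) ->
  (forall i, \int[P]_x ((g (Z i x)) ^+ 2)%:E <= q%:E) ->
  (forall i j A B, i != j -> measurable A -> measurable B ->
     P (Z i @^-1` A `&` Z j @^-1` B) = P (Z i @^-1` A) * P (Z j @^-1` B)) ->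
  {ae P, forall x,
    (fun n => ((\sum_(i < n) g (Z i x)) / n%:R)%R) @ \oo --> mean}.
Proof.
move=> mg g0 Eg Eg2 indep.
apply: (@strong_law_nonneg _ _ _ _ (fun i x => g (Z i x)) mean q) => //.
- by move=> i; exact: measurableT_comp.
- move=> i j ij.
  under eq_integral do rewrite EFinM.
  have mEg : measurable_fun setT (EFin \o g) by exact/measurable_EFinP.
  have Eg0 v : 0 <= (EFin \o g) v by rewrite lee_fin.
  rewrite (@ge0_integral_indep _ _ (Z i) (Z j) (EFin \o g) (EFin \o g))//.
    by rewrite !Eg -EFinM.
  by move=> A B mA mB; exact: indep.
Qed.

Lemma mutually_independent_pair (I : choiceType) d1 (V : measurableType d1)
    (Z : I -> {RV P >-> V}) :
  mutually_independent Z -> forall i j A B, i != j -> measurable A -> measurable B ->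
  P (Z i @^-1` A `&` Z j @^-1` B) = P (Z i @^-1` A) * P (Z j @^-1` B).
Proof.
move=> indep i j A B ij mA mB.
have /= := indep [fset i; j]%fset (fun k => if k == i then A else B).
rewrite big_fsetU1/= ?inE// big_seq_fset1 eqxx eq_sym (negbTE ij) => <-; last first.
  by move=> k; case: ifP.
congr (P _); apply/seteqP; split => [x [Ax Bx] k /=|x /= H].
  rewrite !inE => /orP[/eqP->|/eqP->]; first by rewrite eqxx.
  by rewrite eq_sym (negbTE ij).
split; first by have := H i; rewrite /= !inE eqxx => /(_ isT).
by have := H j; rewrite /= !inE eqxx orbT eq_sym (negbTE ij) => /(_ isT).
Qed.

End independence.

Section sampling_averages.
Context d (T : measurableType d) (R : realType) (P : probability T R).
Variables (S : structure) (w t1 t2 y : R) (X Y : nat -> {RV P >-> (R * R)%type}).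
Hypotheses (t1_gt0 : 0 < t1) (t2_gt0 : 0 < t2).
Hypothesis model : sampling_model S (w, t1, t2) y X Y.

(** Every structural map is linear in the noise. *)
Lemma measurable_structural_map :
  measurable_fun setT (structural_map S (w, t1, t2) :
    measurableTypeR R * measurableTypeR R -> measurableTypeR R * measurableTypeR R).
Proof.
have maff a b : measurable_fun setT
    (fun e : measurableTypeR R * measurableTypeR R => a * e.1 + b * e.2).
  by apply: measurable_funD => //; apply: measurable_funM.
have [a [b [a' [b' smE]]]] : exists a b a' b', structural_map S (w, t1, t2) =
    fun e => (a * e.1 + b * e.2, a' * e.1 + b' * e.2).
  case: S; [exists 1, w, 0, 1|exists 1, 0, w, 1|exists 1, 0, 0, 1];
    by apply/funext => -[e1 e2] /=; congr pair; ring.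
by rewrite smE; apply/measurable_fun_pairP; split; exact: maff.
Qed.

(** A linear form in an observational sample is a linear form in the independent
noise terms, whose square has the expectation a^2 t1 + b^2 t2. *)
Lemma cvg_obs_average (al be a b : R) :
  (forall e, al * (structural_map S (w, t1, t2) e).1 +
             be * (structural_map S (w, t1, t2) e).2 = a * e.1 + b * e.2) ->
  {ae P, forall x, (fun n => (\sum_(i < n)
     (al * (X i x).1 + be * (X i x).2) ^+ 2) / n%:R) @ \oo -->
     a ^+ 2 * t1 + b ^+ 2 * t2}.
Proof.
move=> smE; have [lawX _ indep] := model.
have mform : measurable_fun setT
    (fun v : measurableTypeR R * measurableTypeR R => al * v.1 + be * v.2).
  by apply: measurable_funD; apply: measurable_funM.
have [s1 s2] : 0 < Num.sqrt t1 /\ 0 < Num.sqrt t2 by rewrite !sqrtr_gt0.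
have E (f : R -> \bar R) i : measurable_fun setT f -> (forall v, (0 <= f v)%E) ->
    (\int[P]_x f (al * (X i x).1 + be * (X i x).2)%R =
     \int[normal_prob 0 (Num.sqrt t1) \x normal_prob 0 (Num.sqrt t2)]_e
        f (a * e.1 + b * e.2 + 0)%R)%E.
  move=> mf f0.
  rewrite (@ge0_integral_law _ _ _ P _ _ _ _
      (normal_prob 0 (Num.sqrt t1) \x normal_prob 0 (Num.sqrt t2))%E
      (structural_map S (w, t1, t2)) (X i) (fun v => f (al * v.1 + be * v.2)%R))//.
  - by apply: eq_integral => e _; rewrite smE addr0.
  - exact: measurable_structural_map.
  - by move=> A mA; exact: lawX.
  - exact: measurableT_comp.
apply: (@strong_law_iid _ _ _ P _ _ X (fun v => (al * v.1 + be * v.2) ^+ 2) _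
  (fine (\int[normal_prob 0 (Num.sqrt t1) \x normal_prob 0 (Num.sqrt t2)]_e
     ((a * e.1 + b * e.2 + 0) ^+ 4)%:E)%E)).
- exact: measurable_funX.
- by move=> v; rewrite sqr_ge0.
- move=> i; rewrite (E (fun z => (z ^+ 2)%:E)); last 2 first.
  + by apply/measurable_EFinP; exact: measurable_funX.
  + by move=> v; rewrite lee_fin sqr_ge0.
  rewrite normal_pair_sqr_moment// !sqr_sqrtr ?ltW// !mulr0 !addr0.
  by rewrite expr0n/= addr0.
- move=> i; under eq_integral do rewrite -exprM.
  rewrite (E (fun z => (z ^+ 4)%:E)); last 2 first.
  + by apply/measurable_EFinP; exact: measurable_funX.
  + by move=> v; rewrite lee_fin exprn_even_ge0.
  rewrite fineK// ge0_fin_numE; first exact: normal_pair_pow4_lty.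
  by apply: integral_ge0 => e _; rewrite lee_fin exprn_even_ge0.
- move=> i j A B ij mA mB.
  by have /(_ (inl i) (inl j)) := mutually_independent_pair indep; apply.
Qed.

Lemma cvg_int_average (c : R) :
  {ae P, forall x, (fun n => (\sum_(i < n) ((Y i x).1 + c) ^+ 2) / n%:R) @ \oo -->
     t1 + (do_mean S (w, t1, t2) y + c) ^+ 2}.
Proof.
have [_ lawY indep] := model.
have mform : measurable_fun setT (fun v : measurableTypeR R * measurableTypeR R => v.1 + c).
  exact: measurable_funD.
have s1 : 0 < Num.sqrt t1 by rewrite sqrtr_gt0.
set m := do_mean _ _ _.
have E (f : R -> \bar R) i : measurable_fun setT f -> (forall v, (0 <= f v)%E) ->
    (\int[P]_x f ((Y i x).1 + c)%R =
     \int[normal_prob m (Num.sqrt t1)]_v f (v + c)%R)%E.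
  move=> mf f0.
  rewrite (@ge0_integral_law _ _ _ P _ _ (measurableTypeR R) (R * R)%type
      (normal_prob m (Num.sqrt t1)) (fun v => (v, y)) (Y i)
      (fun v => f (v.1 + c)%R))//.
  - by move=> A mA; exact: lawY.
  - exact: measurableT_comp.
apply: (@strong_law_iid _ _ _ P _ _ Y (fun v => (v.1 + c) ^+ 2) _
  (fine (\int[normal_prob m (Num.sqrt t1)]_v ((v + c) ^+ 4)%:E)%E)).
- exact: measurable_funX.
- by move=> v; rewrite sqr_ge0.
- move=> i; rewrite (E (fun z => (z ^+ 2)%:E)); last 2 first.
  + by apply/measurable_EFinP; exact: measurable_funX.
  + by move=> v; rewrite lee_fin sqr_ge0.
  by rewrite normal_sqr_moment// sqr_sqrtr ?ltW.
- move=> i; under eq_integral do rewrite -exprM.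
  rewrite (E (fun z => (z ^+ 4)%:E)); last 2 first.
  + by apply/measurable_EFinP; exact: measurable_funX.
  + by move=> v; rewrite lee_fin exprn_even_ge0.
  rewrite fineK// ge0_fin_numE; first exact: normal_pow4_lty.
  by apply: integral_ge0 => e _; rewrite lee_fin exprn_even_ge0.
- move=> i j A B ij mA mB.
  by have /(_ (inr i) (inr j)) := mutually_independent_pair indep; apply.
Qed.

End sampling_averages.

(** * The log-likelihood and its profile *)

Section profile.
Context (R : realType).
Implicit Types r w t q : R.

(** The common shape of the log-likelihood per sample.  The triples (a, b, c) are
the coefficients of the quadratic polynomials a - 2 w b + w^2 c, the mean squared
residuals of the regressions with slope w for the first and the second
coordinate. *)
Definition mean_loglik r a1 b1 c1 a2 b2 c2 (th : R * R * R) : R :=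
  - ((ln (2 * pi * th.1.2) + r * ln (2 * pi * th.2) +
      (a1 - 2 * th.1.1 * b1 + th.1.1 ^+ 2 * c1) / th.1.2 +
      (a2 - 2 * th.1.1 * b2 + th.1.1 ^+ 2 * c2) / th.2) / 2).

(** The maximum of [mean_loglik] when q1 and q2 are the minima over w of its two
quadratic polynomials; it is attained at t1 = q1 and t2 = q2 / r. *)
Definition profile r q1 q2 : R :=
  - ((ln (2 * pi * q1) + 1 + r * (ln (2 * pi * (q2 / r)) + 1)) / 2).

Lemma ln_pi_mul t : 0 < t -> ln (2 * pi * t) = ln (2 * pi : R) + ln t.
Proof. by move=> t0; rewrite lnM ?posrE ?mulr_gt0 ?pi_gt0. Qed.

Lemma ln_add_div_ge t q Q : 0 < t -> 0 < q -> q <= Q ->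
  ln (2 * pi * q) + 1 <= ln (2 * pi * t) + Q / t.
Proof.
move=> t0 q0 qQ; rewrite !ln_pi_mul//.
have := @le_ln1Dx _ (q / t - 1).
rewrite addrCA subrr addr0 ln_div ?posrE// => H.
have : -1 < q / t - 1 by rewrite ltrBDr addNr divr_gt0.
move/H; have : q / t <= Q / t by rewrite ler_pM2r ?invr_gt0.
lra.
Qed.

(** The residuals are bounded below by their minima over w; what remains is
separate in t1 and t2, each variance being handled by [ln_add_div_ge]. *)
Lemma mean_loglik_le_profile r a1 b1 c1 a2 b2 c2 q1 q2 th :
  0 < r -> 0 < q1 -> 0 < q2 ->
  (forall w, q1 <= a1 - 2 * w * b1 + w ^+ 2 * c1) ->
  (forall w, q2 <= a2 - 2 * w * b2 + w ^+ 2 * c2) ->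
  Theta th -> mean_loglik r a1 b1 c1 a2 b2 c2 th <= profile r q1 q2.
Proof.
move=> r0 q10 q20 H1 H2 [t10 t20]; rewrite /mean_loglik /profile lerN2.
rewrite ler_pM2r ?invr_gt0//.
have h1 := ln_add_div_ge t10 q10 (H1 th.1.1).
set Q := a2 - _ + _.
have h2 : r * (ln (2 * pi * (q2 / r)) + 1) <= r * ln (2 * pi * th.2) + Q / th.2.
  have -> : r * ln (2 * pi * th.2) + Q / th.2 =
            r * (ln (2 * pi * th.2) + Q / r / th.2).
    by field; rewrite !gt_eqF.
  rewrite ler_pM2l// ln_add_div_ge ?divr_gt0//.
  by rewrite ler_pM2r ?invr_gt0// /Q.
by move: h1 h2; lra.
Qed.

Lemma mean_loglik_eq_profile r a1 b1 c1 a2 b2 c2 w q1 q2 :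
  0 < r -> 0 < q1 -> 0 < q2 ->
  a1 - 2 * w * b1 + w ^+ 2 * c1 = q1 ->
  a2 - 2 * w * b2 + w ^+ 2 * c2 = q2 ->
  mean_loglik r a1 b1 c1 a2 b2 c2 (w, q1, q2 / r) = profile r q1 q2.
Proof.
move=> r0 q10 q20 H1 H2; rewrite /mean_loglik /profile /= H1 H2.
by field; rewrite !gt_eqF.
Qed.

Lemma cvg_lnM_pi T (F : set_system T) (FF : Filter F) (f : T -> R) t :
  0 < t -> f @ F --> t -> (fun x => ln (2 * pi * f x)) @ F --> ln (2 * pi * t).
Proof.
move=> t0 ft; apply: continuous_cvg; last by apply: cvgM => //; exact: cvg_cst.
by apply: continuous_ln; rewrite !mulr_gt0 ?pi_gt0.
Qed.

Lemma cvg_profile T (F : set_system T) (FF : Filter F) (r q1 q2 : T -> R) r' q1' q2' :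
  0 < r' -> 0 < q1' -> 0 < q2' ->
  r @ F --> r' -> q1 @ F --> q1' -> q2 @ F --> q2' ->
  (fun x => profile (r x) (q1 x) (q2 x)) @ F --> profile r' q1' q2'.
Proof.
move=> r0 q10 q20 cr c1 c2.
apply: cvgN; apply: cvgM; last exact: cvg_cst.
apply: cvgD.
  by apply: cvgD; [exact: cvg_lnM_pi|exact: cvg_cst].
apply: cvgM => //; apply: cvgD; last exact: cvg_cst.
apply: cvg_lnM_pi; first by rewrite divr_gt0.
by apply: cvgM => //; apply: cvgV => //; rewrite gt_eqF.
Qed.

Lemma cvg_mean_loglik T (F : set_system T) (FF : Filter F)
    (r a1 b1 c1 a2 b2 c2 : T -> R) (th : T -> R * R * R)
    r' a1' b1' c1' a2' b2' c2' th' : Theta th' ->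
  r @ F --> r' -> a1 @ F --> a1' -> b1 @ F --> b1' -> c1 @ F --> c1' ->
  a2 @ F --> a2' -> b2 @ F --> b2' -> c2 @ F --> c2' -> th @ F --> th' ->
  (fun x => mean_loglik (r x) (a1 x) (b1 x) (c1 x) (a2 x) (b2 x) (c2 x) (th x))
    @ F --> mean_loglik r' a1' b1' c1' a2' b2' c2' th'.
Proof.
move=> [t10 t20] cr ca1 cb1 cc1 ca2 cb2 cc2 cth.
have cw : (fun x => (th x).1.1) @ F --> th'.1.1.
  by apply: (cvg_comp _ (fun z => z.1.1) cth); apply: cvg_comp; exact: cvg_fst.
have ct1 : (fun x => (th x).1.2) @ F --> th'.1.2.
  by apply: (cvg_comp _ (fun z => z.1.2) cth); apply: cvg_comp; [exact: cvg_fst|exact: cvg_snd].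
have ct2 : (fun x => (th x).2) @ F --> th'.2.
  by apply: (cvg_comp _ snd cth); exact: cvg_snd.
have quad (a b c : T -> R) a' b' c' : a @ F --> a' -> b @ F --> b' -> c @ F --> c' ->
   (fun x => a x - 2 * (th x).1.1 * b x + (th x).1.1 ^+ 2 * c x) @ F -->
     a' - 2 * th'.1.1 * b' + th'.1.1 ^+ 2 * c'.
  move=> ca cb cc; apply: cvgD; last by apply: cvgM => //; apply: cvgM.
  apply: cvgB => //; apply: cvgM => //; apply: cvgM => //; exact: cvg_cst.
apply: cvgN; apply: cvgM; last exact: cvg_cst.
apply: cvgD; last first.
  by apply: cvgM; [exact: quad|apply: cvgV => //; rewrite gt_eqF].
apply: cvgD; last first.
  by apply: cvgM; [exact: quad|apply: cvgV => //; rewrite gt_eqF].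
by apply: cvgD; [exact: cvg_lnM_pi|apply: cvgM => //; exact: cvg_lnM_pi].
Qed.

End profile.

Section likelihood.
Context (R : realType).
Implicit Types (y : R) (xs ys : nat -> R * R) (th : R * R * R).

Lemma normal_pdf_expR (m t x : R) : 0 < t ->
  normal_pdf m (Num.sqrt t) x = expR (- ((ln (2 * pi * t) + (x - m) ^+ 2 / t) / 2)).
Proof.
move=> t0; have st0 : 0 < Num.sqrt t by rewrite sqrtr_gt0.
have tpi : 0 < t * pi *+ 2 by rewrite pmulrn_lgt0// mulr_gt0 ?pi_gt0.
rewrite /normal_pdf gt_eqF// /normal_peak /normal_fun sqr_sqrtr ?ltW//.
have -> : (Num.sqrt (t * pi *+ 2))^-1 = expR (- (ln (2 * pi * t) / 2)).
  rewrite expRN; congr (_^-1).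
  rewrite -(@lnK _ (Num.sqrt _)) ?posrE ?sqrtr_gt0//; congr expR.
  have -> : 2 * pi * t = Num.sqrt (t * pi *+ 2) ^+ 2.
    by rewrite sqr_sqrtr ?ltW//; ring.
  by rewrite lnXn ?sqrtr_gt0// -mulr_natl; field.
by rewrite -expRD; congr expR; field; rewrite gt_eqF.
Qed.

Lemma sum_cst_ord k (c : R) : \sum_(i < k) c = k%:R * c.
Proof. by rewrite sumr_const card_ord mulr_natl. Qed.

(** Under S1 the first coordinates of all samples are regressed on the second
ones, which equal y in the interventional samples; the second coordinates of the
observational samples are pure noise. *)
Lemma likelihood_S1E y n m xs ys th : Theta th -> (0 < n + m)%N ->
  likelihood y n m xs ys S1 th = expR ((n + m)%:R * mean_loglik (n%:R / (n + m)%:R)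
    ((\sum_(i < n) (xs i).1 ^+ 2 + \sum_(j < m) (ys j).1 ^+ 2) / (n + m)%:R)
    ((\sum_(i < n) (xs i).1 * (xs i).2 + y * \sum_(j < m) (ys j).1) / (n + m)%:R)
    ((\sum_(i < n) (xs i).2 ^+ 2 + m%:R * y ^+ 2) / (n + m)%:R)
    ((\sum_(i < n) (xs i).2 ^+ 2) / (n + m)%:R) 0 0 th).
Proof.
case: th => [[w t1] t2] [/= t10 t20] nm.
have nm0 : (n + m)%:R != 0 :> R by rewrite pnatr_eq0 -lt0n.
have Ex x : obs_density S1 (w, t1, t2) x =
    expR (- ((ln (2 * pi * t1) + ln (2 * pi * t2)) / 2)
   - (2 * t1)^-1 * x.1 ^+ 2 + (w / t1) * (x.1 * x.2)
   - (w ^+ 2 / (2 * t1) + (2 * t2)^-1) * x.2 ^+ 2).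
  rewrite /obs_density !normal_pdf_expR// -expRD; congr expR.
  by field; rewrite !gt_eqF.
have Ey v : int_density S1 (w, t1, t2) y v =
    expR (- ((ln (2 * pi * t1) + w ^+ 2 * y ^+ 2 / t1) / 2)
   - (2 * t1)^-1 * v ^+ 2 + (w * y / t1) * v).
  rewrite /int_density /= normal_pdf_expR//; congr expR.
  by field; rewrite gt_eqF.
rewrite /likelihood (eq_bigr _ (fun (i : 'I_n) _ => Ex (xs i))).
rewrite (eq_bigr _ (fun (j : 'I_m) _ => Ey (ys j).1)) -!expR_sum -expRD; congr expR.
rewrite !big_split/= !sumrN -!mulr_sumr !sum_cst_ord.
rewrite /mean_loglik/=.
have : (n + m)%:R = n%:R + m%:R :> R by rewrite natrD.
move: (n + m)%:R nm0 => N N0 NE; move: n%:R m%:R NE => rn rm NE.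
have {NE}-> : rm = N - rn by rewrite NE addrAC subrr add0r.
move: (\sum_(i < n) (xs i).1 ^+ 2) (\sum_(i < n) (xs i).1 * (xs i).2)
  (\sum_(i < n) (xs i).2 ^+ 2) (\sum_(j < m) (ys j).1 ^+ 2)
  (\sum_(j < m) (ys j).1) (ln (2 * pi * t1)) (ln (2 * pi * t2)).
move=> A11 A12 A22 B2 B1 l1 l2 {Ex Ey}.
have {}t10 : t1 != 0 by rewrite gt_eqF.
have {}t20 : t2 != 0 by rewrite gt_eqF.
by field; rewrite N0 t10 t20.
Qed.

(** Under S2 the first coordinates of all samples are pure noise, and only
observational samples enter the regression of the second coordinate. *)
Lemma likelihood_S2E y n m xs ys th : Theta th -> (0 < n + m)%N ->
  likelihood y n m xs ys S2 th = expR ((n + m)%:R * mean_loglik (n%:R / (n + m)%:R)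
    ((\sum_(i < n) (xs i).1 ^+ 2 + \sum_(j < m) (ys j).1 ^+ 2) / (n + m)%:R) 0 0
    ((\sum_(i < n) (xs i).2 ^+ 2) / (n + m)%:R)
    ((\sum_(i < n) (xs i).1 * (xs i).2) / (n + m)%:R)
    ((\sum_(i < n) (xs i).1 ^+ 2) / (n + m)%:R) th).
Proof.
case: th => [[w t1] t2] [/= t10 t20] nm.
have nm0 : (n + m)%:R != 0 :> R by rewrite pnatr_eq0 -lt0n.
have Ex x : obs_density S2 (w, t1, t2) x =
    expR (- ((ln (2 * pi * t1) + ln (2 * pi * t2)) / 2)
   - (2 * t2)^-1 * x.2 ^+ 2 + (w / t2) * (x.1 * x.2)
   - (w ^+ 2 / (2 * t2) + (2 * t1)^-1) * x.1 ^+ 2).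
  rewrite /obs_density !normal_pdf_expR// -expRD; congr expR.
  by field; rewrite !gt_eqF.
have Ey v : int_density S2 (w, t1, t2) y v =
    expR (- (ln (2 * pi * t1) / 2) - (2 * t1)^-1 * v ^+ 2).
  rewrite /int_density /= normal_pdf_expR//; congr expR.
  by field; rewrite gt_eqF.
rewrite /likelihood (eq_bigr _ (fun (i : 'I_n) _ => Ex (xs i))).
rewrite (eq_bigr _ (fun (j : 'I_m) _ => Ey (ys j).1)) -!expR_sum -expRD; congr expR.
rewrite !big_split/= !sumrN -!mulr_sumr !sum_cst_ord.
rewrite /mean_loglik/=.
have : (n + m)%:R = n%:R + m%:R :> R by rewrite natrD.
move: (n + m)%:R nm0 => N N0 NE; move: n%:R m%:R NE => rn rm NE.
have {NE}-> : rm = N - rn by rewrite NE addrAC subrr add0r.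
move: (\sum_(i < n) (xs i).1 ^+ 2) (\sum_(i < n) (xs i).1 * (xs i).2)
  (\sum_(i < n) (xs i).2 ^+ 2) (\sum_(j < m) (ys j).1 ^+ 2)
 (ln (2 * pi * t1)) (ln (2 * pi * t2)).
move=> A11 A12 A22 B2 l1 l2 {Ex Ey}.
have {}t10 : t1 != 0 by rewrite gt_eqF.
have {}t20 : t2 != 0 by rewrite gt_eqF.
by field; rewrite N0 t10 t20.
Qed.

Lemma likelihood_S3E1 y n m xs ys (t1 t2 : R) :
  likelihood y n m xs ys S3 (0, t1, t2) = likelihood y n m xs ys S1 (0, t1, t2).
Proof.
rewrite /likelihood /int_density /=; congr (_ * _).
  by apply: eq_bigr => i _; rewrite mul0r.
by apply: eq_bigr => i _; rewrite mul0r.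
Qed.

Lemma likelihood_S3E2 y n m xs ys (t1 t2 : R) :
  likelihood y n m xs ys S3 (0, t1, t2) = likelihood y n m xs ys S2 (0, t1, t2).
Proof.
rewrite /likelihood /int_density /=; congr (_ * _).
by apply: eq_bigr => i _; rewrite mul0r.
Qed.

End likelihood.

(** * Integrals against a prior density *)

Section weighted_integral.
Context d (V : measurableType d) (R : realType).
Variables (mu : {measure set V -> \bar R}) (D : set V) (p f : V -> R) (b B : R).
Hypotheses (mD : measurable D) (p_density : prior_density mu D p).
Hypotheses (mf : measurable_fun D f) (f_ge0 : forall v, D v -> 0 <= f v)
  (B_ge0 : 0 <= B) (f_le : forall v, D v -> f v <= B).

Let mp : measurable_fun D p. Proof. by case: p_density. Qed.

Let p_ge0 v : D v -> 0 <= p v. Proof. by case: p_density => _ + _; apply. Qed.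

Let mfp : measurable_fun D (fun v => (f v * p v)%:E).
Proof. by apply/measurable_EFinP; exact: measurable_funM. Qed.

Let fp_ge0 v : D v -> (0 <= (f v * p v)%:E)%E.
Proof. by move=> Dv; rewrite lee_fin mulr_ge0 ?f_ge0 ?p_ge0. Qed.

Let int_le : (\int[mu]_(v in D) (f v * p v)%:E <= B%:E)%E.
Proof.
have [_ _ p1] := p_density.
rewrite -[B%:E]mule1 -p1 -ge0_integralZl//; last exact/measurable_EFinP.
apply: ge0_le_integral => //.
- by apply: measurable_funeM; exact/measurable_EFinP.
- by move=> v Dv; rewrite -EFinM lee_fin ler_wpM2r ?p_ge0 ?f_le.
Qed.

Let int_fin : (\int[mu]_(v in D) (f v * p v)%:E)%E \is a fin_num.
Proof.
rewrite ge0_fin_numE; first by rewrite (le_lt_trans int_le) ?ltry.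
exact: integral_ge0.
Qed.

Lemma weighted_integral_ge0 : 0 <= \int[mu]_(v in D) (f v * p v).
Proof. by apply: Rintegral_ge0 => v Dv; rewrite -lee_fin fp_ge0. Qed.

Lemma weighted_integral_le : \int[mu]_(v in D) (f v * p v) <= B.
Proof. by rewrite -lee_fin fineK. Qed.

Lemma weighted_integral_ge U kappa : measurable U -> U `<=` D -> 0 <= b ->
  (forall v, U v -> b <= f v) -> (kappa%:E <= \int[mu]_(v in U) (p v)%:E)%E ->
  b * kappa <= \int[mu]_(v in D) (f v * p v).
Proof.
move=> mU UD b0 bf kU; rewrite -lee_fin fineK//.
have mpU : measurable_fun U (EFin \o p).
  by apply/measurable_EFinP; exact: measurable_funS mp.
have pU0 v : U v -> (0 <= (p v)%:E)%E by move=> /UD Dv; rewrite lee_fin p_ge0.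
apply: (@le_trans _ _ (\int[mu]_(v in U) (f v * p v)%:E)%E); last first.
  exact: ge0_subset_integral.
rewrite EFinM; apply: (le_trans (lee_wpmul2l _ kU)) => //.
rewrite -ge0_integralZl//.
apply: ge0_le_integral => //.
- by move=> v Uv; rewrite mule_ge0 ?pU0.
- exact: measurable_funeM.
- exact: measurable_funS mfp.
- by move=> v Uv; rewrite -EFinM lee_fin ler_wpM2r ?bf// p_ge0//; exact: UD.
Qed.

End weighted_integral.

Section parameter_space.
Context (R : realType).
Notation mR := (measurableTypeR R).

Lemma measurable_Theta : measurable (Theta : set (mR * mR * mR)).
Proof.
have -> : Theta = (setT `*` `]0, +oo[) `*` `]0, +oo[ :> set (mR * mR * mR).
  by apply/seteqP; split => -[[w t1] t2] /=; rewrite !in_itv/= !andbT => -[]//; case.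
by apply: measurableX => //; exact: measurableX.
Qed.

Lemma measurable_Theta3 : measurable (Theta3 : set (mR * mR)).
Proof.
have -> : Theta3 = `]0, +oo[ `*` `]0, +oo[ :> set (mR * mR).
  by apply/seteqP; split => -[t1 t2] /=; rewrite !in_itv/= !andbT => -[].
exact: measurableX.
Qed.

Lemma nbhs_Theta (th : R * R * R) : Theta th -> nbhs th (Theta : set (R * R * R)).
Proof.
case: th => [[w t1] t2] [/= t10 t20].
have c1 : (fun z : R * R * R => z.1.2) @ (w, t1, t2) --> t1.
  by apply: cvg_comp; [exact: cvg_fst|exact: cvg_snd].
have c2 : (fun z : R * R * R => z.2) @ (w, t1, t2) --> t2 by exact: cvg_snd.
by apply: filterI; [exact: (cvgr_gt _ c1)|exact: (cvgr_gt _ c2)].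
Qed.

Lemma measurable_mean_loglik r a1 b1 c1 a2 b2 c2 :
  measurable_fun (Theta : set (mR * mR * mR))
    (mean_loglik r a1 b1 c1 a2 b2 c2 : mR * mR * mR -> R).
Proof.
(* On the parameter space, the inverse of a variance t is exp (- ln t). *)
pose g (th : mR * mR * mR) : R :=
  - ((ln (2 * pi * th.1.2) + r * ln (2 * pi * th.2) +
      (a1 - 2 * th.1.1 * b1 + th.1.1 ^+ 2 * c1) * expR (- ln th.1.2) +
      (a2 - 2 * th.1.1 * b2 + th.1.1 ^+ 2 * c2) * expR (- ln th.2)) / 2).
apply: (@eq_measurable_fun _ _ _ _ _ g).
  move=> th /set_mem[t10 t20].
  by rewrite /g /mean_loglik !expRN !lnK.
apply: measurable_funTS.
have mw : measurable_fun [set: mR * mR * mR] (fun th => th.1.1 : R).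
  by apply: measurableT_comp.
have m1 : measurable_fun [set: mR * mR * mR] (fun th => th.1.2 : R).
  by apply: measurableT_comp.
have m2 : measurable_fun [set: mR * mR * mR] (fun th => th.2 : R).
  exact: measurable_snd.
have mq a b' c : measurable_fun [set: mR * mR * mR]
    (fun th => a - 2 * th.1.1 * b' + th.1.1 ^+ 2 * c : R).
  apply: measurable_funD; last first.
    by apply: measurable_funM => //; exact: measurable_funX.
  by apply: measurable_funB => //; apply: measurable_funM => //; apply: measurable_funM.
have mln (h : mR * mR * mR -> R) : measurable_fun setT h ->
    measurable_fun setT (fun th => ln (2 * pi * h th)).
  by move=> mh; apply: measurableT_comp; [exact: measurable_ln|exact: measurable_funM].
have minv (h : mR * mR * mR -> R) : measurable_fun setT h ->
    measurable_fun setT (fun th => expR (- ln (h th))).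
  move=> mh; apply: measurableT_comp => //; apply: measurableT_comp => //.
  by apply: measurableT_comp => //; exact: measurable_ln.
rewrite /g; apply: measurableT_comp => //; apply: measurable_funM => //.
apply: measurable_funD; last by apply: measurable_funM; [exact: mq|exact: minv].
apply: measurable_funD; last by apply: measurable_funM; [exact: mq|exact: minv].
by apply: measurable_funD; [exact: mln|apply: measurable_funM => //; exact: mln].
Qed.

Lemma leb3_ball w t1 t2 e : 0 <= e ->
  @leb3 R (ball (w, t1, t2) e) = ((e *+ 2) ^+ 3)%:E.
Proof.
move=> e0.
have -> : ball (w, t1, t2) e = ball w e `*` ball t1 e `*` ball t2 e.
  by apply/seteqP; split => -[[? ?] ?] [] // [].
rewrite [LHS]product_measure1E; last 2 first.
- by apply: measurableX; exact: measurable_ball.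
- exact: measurable_ball.
rewrite [X in (X * _)%E]product_measure1E; last 2 first.
- exact: measurable_ball.
- exact: measurable_ball.
transitivity ((e *+ 2)%:E * (e *+ 2)%:E * (e *+ 2)%:E)%E.
  by congr (_ * _ * _)%E; exact: lebesgue_measure_ball.
by rewrite -!EFinM -expr2 -exprSr.
Qed.

(** Full support gives a point near th where the prior density is positive, and
continuity keeps it above half its value there on a whole ball. *)
Lemma prior_mass_gt0 (p : R * R * R -> R) (th : R * R * R) (B : set (R * R * R)) :
  prior_density (@leb3 R) Theta p -> (forall v, Theta v -> differentiable p v) ->
  full_support Theta p -> Theta th -> nbhs th B ->
  exists U kappa, [/\ @measurable _ (mR * mR * mR)%type U, U `<=` Theta, U `<=` B,
    0 < kappa & (kappa%:E <= \int[@leb3 R]_(v in U) (p v)%:E)%E].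
Proof.
move=> [mp p0 _] dp supp tht thB.
have [v [[tv pv] /= Bv]] : Theta `&` [set v | 0 < p v] `&` B° !=set0.
  by apply: (supp _ tht); exact: nbhs_interior.
have pc : p @ v --> p v by exact: differentiable_continuous (dp _ tv).
have : \forall z \near v, [/\ Theta z, B z & p v / 2 < p z].
  apply: filterS3 (nbhs_Theta tv) Bv (cvgr_gt _ pc (p v / 2) _) => //.
  by rewrite ltr_pdivrMr// ltr_pMr// ltr1n.
move=> /nbhs_ballP[e /= e0 He].
case: v => [[w t1] t2] in tv pv Bv pc He *.
exists (ball (w, t1, t2) e), (p (w, t1, t2) / 2 * (e *+ 2) ^+ 3).
have ballE : ball (w, t1, t2) e = ball w e `*` ball t1 e `*` ball t2 e.
  by apply/seteqP; split => -[[? ?] ?] [] // [].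
have mball : @measurable _ (mR * mR * mR)%type (ball (w, t1, t2) e).
  rewrite ballE; apply: measurableX; last exact: measurable_ball.
  by apply: measurableX; exact: measurable_ball.
split => //.
- by move=> z /He[].
- by move=> z /He[].
- by rewrite mulr_gt0 ?divr_gt0 ?exprn_gt0 ?pmulrn_lgt0.
- apply: (@le_trans _ _ (\int[@leb3 R]_(v in ball (w, t1, t2) e)
      (cst (p (w, t1, t2) / 2)%:E v))%E).
    rewrite integral_cst// EFinM; apply: lee_wpmul2l.
      by rewrite lee_fin divr_ge0// ltW.
    by rewrite leb3_ball// ltW.
  apply: ge0_le_integral => //.
  + by move=> z _; rewrite lee_fin divr_ge0// ltW.
  + by apply/measurable_EFinP; apply: measurable_funS mp; [exact: measurable_Theta|move=> z /He[]].
  + by move=> z /He[_ _ pz]; rewrite lee_fin ltW.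
Qed.

End parameter_space.

(** * Exponential rates of marginal likelihoods *)

Section exponential_rates.
Context (R : realType).

(** Stated without logarithms so that eventual positivity of M is part of it. *)
Definition has_exp_rate (M : nat -> R) (L : R) : Prop := forall e, 0 < e ->
  \forall N \near \oo, expR (N%:R * (L - e)) <= M N <= expR (N%:R * (L + e)).

Definition exp_rate_le (M : nat -> R) (L : R) : Prop := forall e, 0 < e ->
  \forall N \near \oo, 0 <= M N <= expR (N%:R * (L + e)).

Lemma near_nat_ge (A : R) : \forall N \near \oo, A <= N%:R.
Proof.
have : (fun N : nat => N%:R : R) @ \oo --> +oo by exact: cvgr_idn.
by move/cvgryPge; apply.
Qed.

(** The inverse posterior probability minus one is (Mb + M3) / Ma.  Adding M3 at
most doubles the upper bound on Mb, and ln 2 / N tends to 0. *)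
Lemma cvg_log_posterior_odds (Ma Mb M3 : nat -> R) La Lb :
  has_exp_rate Ma La -> has_exp_rate Mb Lb -> exp_rate_le M3 Lb ->
  (fun N => N%:R^-1 * ln ((Ma N / (Ma N + Mb N + M3 N))^-1 - 1)) @ \oo --> Lb - La.
Proof.
move=> ha hb h3; apply/cvgrPdist_le => e e0.
have e3 : 0 < e / 3 by rewrite divr_gt0.
near=> N.
have /andP[a1 a2] : expR (N%:R * (La - e / 3)) <= Ma N <= expR (N%:R * (La + e / 3)).
  by near: N; exact: ha.
have /andP[b1 b2] : expR (N%:R * (Lb - e / 3)) <= Mb N <= expR (N%:R * (Lb + e / 3)).
  by near: N; exact: hb.
have /andP[c1 c2] : 0 <= M3 N <= expR (N%:R * (Lb + e / 3)) by near: N; exact: h3.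
have N0 : 0 < N%:R :> R.
  by rewrite (lt_le_trans ltr01)//; near: N; exact: near_nat_ge.
have N2 : ln 2 <= N%:R * (e / 3).
  by rewrite -ler_pdivrMr//; near: N; exact: near_nat_ge.
have Ma0 : 0 < Ma N by rewrite (lt_le_trans _ a1) ?expR_gt0.
have Mb0 : 0 < Mb N by rewrite (lt_le_trans _ b1) ?expR_gt0.
have -> : (Ma N / (Ma N + Mb N + M3 N))^-1 - 1 = (Mb N + M3 N) / Ma N.
  by field; rewrite !gt_eqF//; lra.
have Mb3 : 0 < Mb N + M3 N by lra.
rewrite ln_div ?posrE// distrC.
have la1 : N%:R * (La - e / 3) <= ln (Ma N).
  by rewrite -[leLHS]expRK ler_ln ?posrE ?expR_gt0.
have la2 : ln (Ma N) <= N%:R * (La + e / 3).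
  by rewrite -[leRHS]expRK ler_ln ?posrE ?expR_gt0.
have lb1 : N%:R * (Lb - e / 3) <= ln (Mb N + M3 N).
  by rewrite -[leLHS]expRK ler_ln ?posrE ?expR_gt0//; lra.
have lb2 : ln (Mb N + M3 N) <= ln 2 + N%:R * (Lb + e / 3).
  rewrite -[N%:R * (Lb + _)]expRK -lnM ?posrE ?expR_gt0//.
  by rewrite ler_ln ?posrE ?mulr_gt0 ?expR_gt0//; lra.
rewrite ler_norml; apply/andP; split.
- rewrite -(ler_pM2l N0) mulrBr mulrA divff ?gt_eqF// mul1r.
  by move: la1 la2 lb1; nra.
- rewrite -(ler_pM2l N0) mulrBr mulrA divff ?gt_eqF// mul1r.
  by move: la1 la2 lb2; nra.
Unshelve. all: by end_near. Qed.

End exponential_rates.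

Section marginal_rate.
Context (R : realType).
Variables (r a1 b1 c1 a2 b2 c2 q1 q2 : nat -> R).
Variables (r' a1' b1' c1' a2' b2' c2' q1' q2' w : R).
Hypotheses (cr : r @ \oo --> r') (ca1 : a1 @ \oo --> a1')
  (cb1 : b1 @ \oo --> b1') (cc1 : c1 @ \oo --> c1') (ca2 : a2 @ \oo --> a2')
  (cb2 : b2 @ \oo --> b2') (cc2 : c2 @ \oo --> c2')
  (cq1 : q1 @ \oo --> q1') (cq2 : q2 @ \oo --> q2').
Hypotheses (r_gt0 : 0 < r') (q1_gt0 : 0 < q1') (q2_gt0 : 0 < q2').
Hypotheses (q1_opt : a1' - 2 * w * b1' + w ^+ 2 * c1' = q1')
           (q2_opt : a2' - 2 * w * b2' + w ^+ 2 * c2' = q2').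
Hypotheses
  (q1_min : \forall N \near \oo, forall v, q1 N <= a1 N - 2 * v * b1 N + v ^+ 2 * c1 N)
  (q2_min : \forall N \near \oo, forall v, q2 N <= a2 N - 2 * v * b2 N + v ^+ 2 * c2 N).

Let ell N := mean_loglik (r N) (a1 N) (b1 N) (c1 N) (a2 N) (b2 N) (c2 N).
Let L := profile r' q1' q2'.

(** An upper bound uniform in the parameter: the profile at the empirical minima
bounds the log-likelihood for each N, and it converges to L. *)
Lemma mean_loglik_le_near e : 0 < e ->
  \forall N \near \oo, forall th, Theta th -> ell N th <= L + e.
Proof.
move=> e0; near=> N => th tth.
have r0 : 0 < r N by near: N; exact: (cvgr_gt _ cr).
have q10 : 0 < q1 N by near: N; exact: (cvgr_gt _ cq1).
have q20 : 0 < q2 N by near: N; exact: (cvgr_gt _ cq2).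
apply: (@le_trans _ _ (profile (r N) (q1 N) (q2 N))).
  by apply: mean_loglik_le_profile => //; near: N.
near: N; apply: (cvgr_le L); last by rewrite ltrDl.
exact: cvg_profile.
Unshelve. all: by end_near. Qed.

(** Joint convergence in N and the parameter, that is, along the product of the
filters at infinity and at the maximiser, gives a neighbourhood that does not
depend on N. *)
Lemma mean_loglik_ge_near e : 0 < e ->
  exists2 B, nbhs (w, q1', q2' / r') B &
  \forall N \near \oo, forall th, B th -> L - e <= ell N th.
Proof.
move=> e0.
have tth : Theta (w, q1', q2' / r') by split=> //=; rewrite divr_gt0.
have : (fun z : nat * (R * R * R) => ell z.1 z.2) @
    filter_prod \oo (nbhs (w, q1', q2' / r')) --> L.
  rewrite /L -(mean_loglik_eq_profile r_gt0 q1_gt0 q2_gt0 q1_opt q2_opt).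
  have c1st (u : nat -> R) l : u @ \oo --> l ->
      (fun z : nat * (R * R * R) => u z.1) @
        filter_prod \oo (nbhs (w, q1', q2' / r')) --> l.
    by move=> ul; apply: (cvg_comp fst u _ ul); exact: cvg_fst.
  by apply: cvg_mean_loglik => //; [exact: c1st..|exact: cvg_snd].
move=> /cvgr_ge/(_ (L - e)).
rewrite ltrBlDr ltrDl => /(_ e0)[[A B] /= [AN Bth]] AB.
exists B => //; apply: filterS AN => N AN th Bth'.
exact: (AB (N, th)).
Qed.

(** The slice w = 0 inherits the uniform upper bound on the log-likelihood. *)
Lemma marginal3_exp_rate_le (p3 : R * R -> R) :
  prior_density (@leb2 R) Theta3 p3 ->
  exp_rate_le (fun N => \int[@leb2 R]_(t in Theta3)
    (expR (N%:R * ell N (0, t.1, t.2)) * p3 t)) L.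
Proof.
move=> p3_density e e0; near=> N.
have le_e : forall t : measurableTypeR R * measurableTypeR R, Theta3 t ->
    expR (N%:R * ell N (0, t.1, t.2)) <= expR (N%:R * (L + e)).
  move=> t [t10 t20]; rewrite ler_expR ler_wpM2l//.
  have : Theta (0, t.1, t.2) by split.
  by move: {t t10 t20} (0, t.1, t.2); near: N; exact: mean_loglik_le_near.
have mexp : @measurable_fun _ _ (measurableTypeR R * measurableTypeR R)%type
    R Theta3 (fun t => expR (N%:R * ell N (0, t.1, t.2))).
  apply: measurableT_comp => //; apply: measurable_funM => //.
  apply: (measurable_comp (f := ell N) (g := fun t => (0, t.1, t.2)) (F := Theta :
    set (measurableTypeR R * measurableTypeR R * measurableTypeR R))).
  - exact: measurable_Theta.
  - by move=> _ [t [t10 t20] <-].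
  - exact: measurable_mean_loglik.
  - apply: measurable_funTS.
    have mpair : measurable_fun [set: measurableTypeR R * measurableTypeR R]
        (fun t => ((0 : measurableTypeR R), t.1)).
      by apply: measurable_fun_pair.
    by apply: (measurable_fun_pair mpair).
apply/andP; split.
- apply: weighted_integral_ge0 => //.
- by apply: weighted_integral_le => //; exact: measurable_Theta3.
Unshelve. all: by end_near. Qed.

Variable p : R * R * R -> R.
Hypotheses (p_density : prior_density (@leb3 R) Theta p)
  (p_diff : forall v, Theta v -> differentiable p v)
  (p_supp : full_support Theta p).

(** Laplace's principle: at the exponential scale, only the maximum of the
log-likelihood survives the integration. *)
Lemma marginal_exp_rate :
  has_exp_rate (fun N => \int[@leb3 R]_(th in Theta) (expR (N%:R * ell N th) * p th)) L.
Proof.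
move=> e e0.
have e2 : 0 < e / 2 by rewrite divr_gt0.
have [B Bth HB] := mean_loglik_ge_near e2.
have tth : Theta (w, q1', q2' / r') by split=> //=; rewrite divr_gt0.
have [U [kappa [mU UT UB k0 kU]]] := prior_mass_gt0 p_density p_diff p_supp tth Bth.
near=> N.
have le_e : forall th, Theta th -> expR (N%:R * ell N th) <= expR (N%:R * (L + e)).
  move=> th tth'; rewrite ler_expR ler_wpM2l//.
  by move: th tth'; near: N; exact: mean_loglik_le_near.
have mexp : @measurable_fun _ _ (measurableTypeR R * measurableTypeR R * measurableTypeR R)%type
    R Theta (fun th => expR (N%:R * ell N th)).
  by apply: measurableT_comp => //; apply: measurable_funM => //;
    exact: measurable_mean_loglik.
have exp0 : forall th : measurableTypeR R * measurableTypeR R * measurableTypeR R,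
  Theta th -> 0 <= expR (N%:R * ell N th) by move=> *; exact: expR_ge0.
apply/andP; split; last first.
  by apply: weighted_integral_le => //; exact: measurable_Theta.
apply: (@le_trans _ _ (expR (N%:R * (L - e / 2)) * kappa)).
  have -> : N%:R * (L - e) = N%:R * (L - e / 2) - N%:R * (e / 2) by field.
  rewrite expRD ler_pM2l ?expR_gt0// -[leRHS]lnK ?posrE// ler_expR.
  rewrite lerNl -ler_pdivrMr//; near: N; exact: near_nat_ge.
apply: (@weighted_integral_ge _ _ _ _ _ _ _ _ (expR (N%:R * (L + e))) _ _ _ _ _ _ U) => //.
- exact: measurable_Theta.
- move=> th Uth; rewrite ler_expR ler_wpM2l//.
  by move: th Uth; near: N; apply: filterS HB => N HB th /UB; exact: HB.
Unshelve. all: by end_near. Qed.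

End marginal_rate.

(** * Rates of the two competing fits *)

Section quadratic_minimum.
Context (R : realType).

(** The least squares residual is the minimum over the slope. *)
Lemma quadratic_ge (a b c v : R) : 0 < c ->
  a - b ^+ 2 / c <= a - 2 * v * b + v ^+ 2 * c.
Proof.
move=> c0; rewrite -subr_ge0.
have -> : a - 2 * v * b + v ^+ 2 * c - (a - b ^+ 2 / c) = c * (v - b / c) ^+ 2.
  by field; rewrite gt_eqF.
by rewrite mulr_ge0 ?sqr_ge0 ?ltW.
Qed.

Lemma cvg_quadratic_min (a b c : nat -> R) (a' b' c' : R) : 0 < c' ->
  a @ \oo --> a' -> b @ \oo --> b' -> c @ \oo --> c' ->
  (fun N => a N - b N ^+ 2 / c N) @ \oo --> a' - b' ^+ 2 / c'.
Proof.
move=> c0 ca cb cc; apply: cvgB => //; apply: cvgM; first exact: cvgM.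
by apply: cvgV => //; rewrite gt_eqF.
Qed.

End quadratic_minimum.

Section data.
Context (R : realType).
Variables (prior : @priors R) (y eta : R) (n m : nat -> nat) (xs ys : nat -> R * R).
Hypotheses (n_plus_m : forall N, (n N + m N)%N = N)
  (eta_gt0 : 0 < eta) (eta_lt1 : eta < 1)
  (n_ratio : (fun N => (n N)%:R / N%:R : R) @ \oo --> eta).
Variables (A11 A12 A22 B2 B1 : R).
Hypotheses
  (c11 : (fun N => (\sum_(i < n N) (xs i).1 ^+ 2) / N%:R) @ \oo --> A11)
  (c12 : (fun N => (\sum_(i < n N) (xs i).1 * (xs i).2) / N%:R) @ \oo --> A12)
  (c22 : (fun N => (\sum_(i < n N) (xs i).2 ^+ 2) / N%:R) @ \oo --> A22)
  (cB2 : (fun N => (\sum_(j < m N) (ys j).1 ^+ 2) / N%:R) @ \oo --> B2)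
  (cB1 : (fun N => (\sum_(j < m N) (ys j).1) / N%:R) @ \oo --> B1).

Let c_sum : (fun N => (\sum_(i < n N) (xs i).1 ^+ 2 + \sum_(j < m N) (ys j).1 ^+ 2)
   / N%:R) @ \oo --> A11 + B2.
Proof. by under eq_fun do rewrite mulrDl; exact: cvgD. Qed.

Let c_cross : (fun N => (\sum_(i < n N) (xs i).1 * (xs i).2 +
   y * \sum_(j < m N) (ys j).1) / N%:R) @ \oo --> A12 + y * B1.
Proof.
under eq_fun do rewrite mulrDl -mulrA.
by apply: cvgD => //; apply: cvgM => //; exact: cvg_cst.
Qed.

Lemma cvg_m_ratio : (fun N => (m N)%:R / N%:R : R) @ \oo --> 1 - eta.
Proof.
apply: (@cvg_trans _ ((fun N => 1 - (n N)%:R / N%:R : R) @ \oo)); last first.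
  by apply: cvgB => //; exact: cvg_cst.
apply: near_eq_cvg; near=> N.
have N0 : N%:R != 0 :> R by rewrite pnatr_eq0 -lt0n; near: N; exact: nbhs_infty_gt.
have NE : N%:R = (n N)%:R + (m N)%:R :> R by rewrite -natrD n_plus_m.
apply: (mulIf N0); rewrite /= mulrBl mul1r !divfK// NE; ring.
Unshelve. all: by end_near. Qed.

Let c_pred : (fun N => (\sum_(i < n N) (xs i).2 ^+ 2 + (m N)%:R * y ^+ 2) / N%:R)
  @ \oo --> A22 + (1 - eta) * y ^+ 2.
Proof.
under eq_fun do rewrite mulrDl mulrAC.
by apply: cvgD => //; apply: cvgM; [exact: cvg_m_ratio|exact: cvg_cst].
Qed.

(** The fit of S1 to data with the limiting moments A11, A12, A22, B2 and B1:
a regression without intercept of X(1) and Y(1) on X(2) and y, with residual q1. *)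
Section fit_S1.
Let c := A22 + (1 - eta) * y ^+ 2.
Let q1 := A11 + B2 - (A12 + y * B1) ^+ 2 / c.
Hypotheses (q1_gt0 : 0 < q1) (A22_gt0 : 0 < A22).

Let c_gt0 : 0 < c.
Proof. by rewrite /c ltr_wpDr// mulr_ge0 ?sqr_ge0// subr_ge0 ltW. Qed.

Let w := (A12 + y * B1) / c.

Let q1_opt : A11 + B2 - 2 * w * (A12 + y * B1) + w ^+ 2 * c = q1.
Proof. by rewrite /q1 /w; field; rewrite gt_eqF. Qed.

Let q2_opt : A22 - 2 * w * 0 + w ^+ 2 * 0 = A22.
Proof. by rewrite !mulr0 subr0 addr0. Qed.

Let q1_min : \forall N \near \oo, forall v : R,
  (\sum_(i < n N) (xs i).1 ^+ 2 + \sum_(j < m N) (ys j).1 ^+ 2) / N%:R -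
  ((\sum_(i < n N) (xs i).1 * (xs i).2 + y * \sum_(j < m N) (ys j).1) / N%:R) ^+ 2 /
  ((\sum_(i < n N) (xs i).2 ^+ 2 + (m N)%:R * y ^+ 2) / N%:R) <=
  (\sum_(i < n N) (xs i).1 ^+ 2 + \sum_(j < m N) (ys j).1 ^+ 2) / N%:R -
  2 * v * ((\sum_(i < n N) (xs i).1 * (xs i).2 + y * \sum_(j < m N) (ys j).1) / N%:R) +
  v ^+ 2 * ((\sum_(i < n N) (xs i).2 ^+ 2 + (m N)%:R * y ^+ 2) / N%:R).
Proof.
near=> N => v; apply: quadratic_ge.
by near: N; exact: (cvgr_gt _ c_pred).
Unshelve. all: by end_near. Qed.

Let q2_min : \forall N \near \oo, forall v : R,
  (\sum_(i < n N) (xs i).2 ^+ 2) / N%:R <=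
  (\sum_(i < n N) (xs i).2 ^+ 2) / N%:R - 2 * v * 0 + v ^+ 2 * 0.
Proof. by near=> N => v; rewrite !mulr0 subr0 addr0. Unshelve. all: by end_near. Qed.

Lemma marginal_S1_rate :
  prior_density (@leb3 R) Theta (prior1 prior) ->
  (forall v, Theta v -> differentiable (prior1 prior) v) ->
  full_support Theta (prior1 prior) ->
  has_exp_rate (fun N => marginal prior y (n N) (m N) xs ys S1) (profile eta q1 A22).
Proof.
move=> dens diff supp.
have := marginal_exp_rate n_ratio c_sum c_cross c_pred c22 (cvg_cst 0) (cvg_cst 0)
  (cvg_quadratic_min c_gt0 c_sum c_cross c_pred) c22 eta_gt0 q1_gt0 A22_gt0
  q1_opt q2_opt q1_min q2_min dens diff supp.
move=> H e e0; near=> N.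
have N0 : (0 < n N + m N)%N by rewrite n_plus_m; near: N; exact: nbhs_infty_gt.
rewrite /marginal.
under eq_Rintegral => th tth.
  rewrite likelihood_S1E//; last exact: set_mem.
  rewrite n_plus_m; over.
by near: N; exact: H.
Unshelve. all: by end_near. Qed.

Lemma marginal_S3_rate_le_S1 :
  prior_density (@leb2 R) Theta3 (prior3 prior) ->
  exp_rate_le (fun N => marginal prior y (n N) (m N) xs ys S3) (profile eta q1 A22).
Proof.
move=> dens.
have H := marginal3_exp_rate_le n_ratio
  (cvg_quadratic_min c_gt0 c_sum c_cross c_pred) c22 eta_gt0 q1_gt0 A22_gt0
  q1_min q2_min dens.
move=> e e0; near=> N.
have N0 : (0 < n N + m N)%N by rewrite n_plus_m; near: N; exact: nbhs_infty_gt.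
rewrite /marginal.
under eq_Rintegral => t tt.
  rewrite likelihood_S3E1 likelihood_S1E//; last exact: set_mem tt.
  rewrite n_plus_m; over.
by near: N; exact: H.
Unshelve. all: by end_near. Qed.

End fit_S1.

(** The fit of S2 to the same data: a regression of X(2) on X(1), with residual
q2 per sample. *)
Section fit_S2.
Let q2 := A22 - A12 ^+ 2 / A11.
Hypotheses (A11_gt0 : 0 < A11) (q1_gt0 : 0 < A11 + B2) (q2_gt0 : 0 < q2).

Let w := A12 / A11.

Let q1_opt : A11 + B2 - 2 * w * 0 + w ^+ 2 * 0 = A11 + B2.
Proof. by rewrite !mulr0 subr0 addr0. Qed.

Let q2_opt : A22 - 2 * w * A12 + w ^+ 2 * A11 = q2.
Proof. by rewrite /q2 /w; field; rewrite gt_eqF. Qed.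

Let q1_min : \forall N \near \oo, forall v : R,
  (\sum_(i < n N) (xs i).1 ^+ 2 + \sum_(j < m N) (ys j).1 ^+ 2) / N%:R <=
  (\sum_(i < n N) (xs i).1 ^+ 2 + \sum_(j < m N) (ys j).1 ^+ 2) / N%:R -
  2 * v * 0 + v ^+ 2 * 0.
Proof. by near=> N => v; rewrite !mulr0 subr0 addr0. Unshelve. all: by end_near. Qed.

Let q2_min : \forall N \near \oo, forall v : R,
  (\sum_(i < n N) (xs i).2 ^+ 2) / N%:R -
  ((\sum_(i < n N) (xs i).1 * (xs i).2) / N%:R) ^+ 2 /
  ((\sum_(i < n N) (xs i).1 ^+ 2) / N%:R) <=
  (\sum_(i < n N) (xs i).2 ^+ 2) / N%:R -
  2 * v * ((\sum_(i < n N) (xs i).1 * (xs i).2) / N%:R) +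
  v ^+ 2 * ((\sum_(i < n N) (xs i).1 ^+ 2) / N%:R).
Proof.
near=> N => v; apply: quadratic_ge.
by near: N; exact: (cvgr_gt _ c11).
Unshelve. all: by end_near. Qed.

Lemma marginal_S2_rate :
  prior_density (@leb3 R) Theta (prior2 prior) ->
  (forall v, Theta v -> differentiable (prior2 prior) v) ->
  full_support Theta (prior2 prior) ->
  has_exp_rate (fun N => marginal prior y (n N) (m N) xs ys S2)
    (profile eta (A11 + B2) q2).
Proof.
move=> dens diff supp.
have := marginal_exp_rate n_ratio c_sum (cvg_cst 0) (cvg_cst 0) c22 c12 c11
  c_sum (cvg_quadratic_min A11_gt0 c22 c12 c11) eta_gt0 q1_gt0 q2_gt0
  q1_opt q2_opt q1_min q2_min dens diff supp.
move=> H e e0; near=> N.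
have N0 : (0 < n N + m N)%N by rewrite n_plus_m; near: N; exact: nbhs_infty_gt.
rewrite /marginal.
under eq_Rintegral => th tth.
  rewrite likelihood_S2E//; last exact: set_mem.
  rewrite n_plus_m; over.
by near: N; exact: H.
Unshelve. all: by end_near. Qed.

Lemma marginal_S3_rate_le_S2 :
  prior_density (@leb2 R) Theta3 (prior3 prior) ->
  exp_rate_le (fun N => marginal prior y (n N) (m N) xs ys S3)
    (profile eta (A11 + B2) q2).
Proof.
move=> dens.
have H := marginal3_exp_rate_le n_ratio
  c_sum (cvg_quadratic_min A11_gt0 c22 c12 c11) eta_gt0 q1_gt0 q2_gt0
  q1_min q2_min dens.
move=> e e0; near=> N.
have N0 : (0 < n N + m N)%N by rewrite n_plus_m; near: N; exact: nbhs_infty_gt.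
rewrite /marginal.
under eq_Rintegral => t tt.
  rewrite likelihood_S3E2 likelihood_S2E//; last exact: set_mem tt.
  rewrite n_plus_m; over.
by near: N; exact: H.
Unshelve. all: by end_near. Qed.

End fit_S2.

End data.

(** * Limits of the posterior odds *)

Section partial_averages.
Context (R : realType).

(** Averages over the first k N terms, normalised by N: the sample sizes n and m
both grow linearly in N, so they run through the full sequence of averages. *)
Lemma cvg_partial_average (u : nat -> R) (k : nat -> nat) (l rho : R) :
  0 < rho -> (fun N => (k N)%:R / N%:R : R) @ \oo --> rho ->
  (fun n => (\sum_(i < n) u i) / n%:R) @ \oo --> l ->
  (fun N => (\sum_(i < k N) u i) / N%:R) @ \oo --> rho * l.
Proof.
move=> rho0 kr ul.
have rho2 : 0 < rho / 2 by rewrite divr_gt0.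
have ky : k @ \oo --> \oo.
  apply/cvgnyPge => A; near=> N.
  have N0 : 0 < N%:R :> R.
    by rewrite (lt_le_trans ltr01)//; near: N; exact: near_nat_ge.
  have kN : rho / 2 <= (k N)%:R / N%:R.
    near: N; apply: (cvgr_ge rho) => //.
    by rewrite ltr_pdivrMr// ltr_pMr// ltr1n.
  have NA : A%:R / (rho / 2) <= N%:R by near: N; exact: near_nat_ge.
  rewrite -(ler_nat R) -(ler_pM2r (_ : 0 < N%:R^-1)) ?invr_gt0//.
  apply: le_trans kN; rewrite ler_pdivrMr//.
  by move: NA; rewrite ler_pdivrMr// mulrC.
have ulk := cvg_comp k _ ky ul.
apply: (@cvg_trans _ ((fun N => (k N)%:R / N%:R *
  ((\sum_(i < k N) u i) / (k N)%:R)) @ \oo)); last exact: cvgM.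
apply: near_eq_cvg; near=> N => /=.
have k0 : (k N)%:R != 0 :> R.
  rewrite pnatr_eq0 -lt0n; near: N; move/cvgnyPge : ky; exact.
have N0 : N%:R != 0 :> R by rewrite pnatr_eq0 -lt0n; near: N; exact: nbhs_infty_gt.
by field; rewrite k0 N0.
Unshelve. all: by end_near. Qed.

(** The strong law is about squares of linear forms; products come from
(u + v)^2 = u^2 + 2 u v + v^2. *)
Lemma cvg_average_polarization (u v : nat -> R) (uu uv vv : R) :
  (fun n => (\sum_(i < n) (1 * u i + 0 * v i) ^+ 2) / n%:R) @ \oo --> uu ->
  (fun n => (\sum_(i < n) (0 * u i + 1 * v i) ^+ 2) / n%:R) @ \oo --> vv ->
  (fun n => (\sum_(i < n) (1 * u i + 1 * v i) ^+ 2) / n%:R) @ \oo -->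
    uu + 2 * uv + vv ->
  [/\ (fun n => (\sum_(i < n) u i ^+ 2) / n%:R) @ \oo --> uu,
      (fun n => (\sum_(i < n) v i ^+ 2) / n%:R) @ \oo --> vv &
      (fun n => (\sum_(i < n) u i * v i) / n%:R) @ \oo --> uv].
Proof.
move=> cu cv cw; split.
- rewrite (_ : (fun n => _) =
      fun n => (\sum_(i < n) (1 * u i + 0 * v i) ^+ 2) / n%:R)//.
  by apply/funext => n; congr (_ / _); apply: eq_bigr => i _; ring.
- rewrite (_ : (fun n => _) =
      fun n => (\sum_(i < n) (0 * u i + 1 * v i) ^+ 2) / n%:R)//.
  by apply/funext => n; congr (_ / _); apply: eq_bigr => i _; ring.
- rewrite (_ : (fun n => _) =
      fun n => ((\sum_(i < n) (1 * u i + 1 * v i) ^+ 2) / n%:R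
        - (\sum_(i < n) (1 * u i + 0 * v i) ^+ 2) / n%:R
        - (\sum_(i < n) (0 * u i + 1 * v i) ^+ 2) / n%:R) / 2).
    rewrite (_ : uv = (uu + 2 * uv + vv - uu - vv) / 2); last by field.
    apply: cvgM; last exact: cvg_cst.
    by apply: cvgB => //; exact: cvgB.
  apply/funext => n; rewrite -!mulrBl mulrAC; congr (_ / _).
  by rewrite -!sumrB mulr_suml; apply: eq_bigr => i _; field.
Qed.

(** Likewise (v + 1)^2 - v^2 - 1 = 2 v reduces means to averages of squares. *)
Lemma cvg_average_shift (v : nat -> R) (vv mv : R) :
  (fun n => (\sum_(i < n) (v i + 0) ^+ 2) / n%:R) @ \oo --> vv ->
  (fun n => (\sum_(i < n) (v i + 1) ^+ 2) / n%:R) @ \oo --> vv + 2 * mv + 1 ->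
  (fun n => (\sum_(i < n) v i ^+ 2) / n%:R) @ \oo --> vv /\
  (fun n => (\sum_(i < n) v i) / n%:R) @ \oo --> mv.
Proof.
move=> c0 c1; split.
  rewrite (_ : (fun n => _) = fun n => (\sum_(i < n) (v i + 0) ^+ 2) / n%:R)//.
  by apply/funext => n; congr (_ / _); apply: eq_bigr => i _; ring.
apply: (@cvg_trans _ ((fun n => ((\sum_(i < n) (v i + 1) ^+ 2) / n%:R
   - (\sum_(i < n) (v i + 0) ^+ 2) / n%:R - 1) / 2) @ \oo)); last first.
  rewrite (_ : mv = (vv + 2 * mv + 1 - vv - 1) / 2); last by field.
  apply: cvgM; last exact: cvg_cst.
  by apply: cvgB; [exact: cvgB|exact: cvg_cst].
apply: near_eq_cvg; near=> n => /=.
have n0 : n%:R != 0 :> R by rewrite pnatr_eq0 -lt0n; near: n; exact: nbhs_infty_gt.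
have -> : \sum_(i < n) (v i + 1) ^+ 2 =
    \sum_(i < n) (v i + 0) ^+ 2 + 2 * \sum_(i < n) v i + n%:R.
  rewrite -[n%:R in RHS]mulr1 -(sum_cst_ord n (1 : R)) mulr_sumr -!big_split/=.
  by apply: eq_bigr => i _; ring.
by field.
Unshelve. all: by end_near. Qed.

Lemma profile_gap (r q1 q2 q1' q2' : R) : 0 < r -> 0 < q1 -> 0 < q2 -> 0 < q1' -> 0 < q2' ->
  profile r q1 (r * q2) - profile r q1' (r * q2') =
  - ((ln q1 - ln q1' + r * (ln q2 - ln q2')) / 2) :> R.
Proof.
move=> r0 *; rewrite /profile.
have rK z : r * z / r = z by field; rewrite gt_eqF.
by rewrite !rK !ln_pi_mul//; field.
Qed.

Lemma profile_gap_D12 (y w t1 t2 eta : R) : 0 < eta -> eta < 1 -> 0 < t1 -> 0 < t2 ->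
  profile eta (eta * (w ^+ 2 * t2 + t1) + (1 - eta) * (w ^+ 2 * y ^+ 2 + t1))
    (eta * (t1 * t2 / (w ^+ 2 * t2 + t1))) - profile eta t1 (eta * t2)
  = - D12 y (w, t1, t2) eta :> R.
Proof.
move=> eta0 eta1 t10 t20.
have wt0 z : 0 <= z -> 0 < w ^+ 2 * z + t1 :> R.
  by move=> z0; rewrite ltr_wpDl// mulr_ge0 ?sqr_ge0.
have s0 := wt0 _ (ltW t20); have v0 := wt0 _ (sqr_ge0 y).
have q0 : 0 < eta * (w ^+ 2 * t2 + t1) + (1 - eta) * (w ^+ 2 * y ^+ 2 + t1).
  by rewrite addr_gt0 ?mulr_gt0// subr_gt0.
rewrite profile_gap ?divr_gt0 ?mulr_gt0// /D12.
rewrite !ln_div ?posrE ?mulr_gt0 ?powR_gt0// !lnM ?posrE ?powR_gt0// !ln_powR.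
by field.
Qed.

(** The positivity says that the residual variance of the wrong regression under
S2 is positive. *)
Lemma profile_gap_D21 (y w t1 t2 eta : R) : 0 < eta -> eta < 1 -> 0 < t1 -> 0 < t2 ->
  let s := w ^+ 2 * t1 + t2 in
  let c := eta * s + (1 - eta) * y ^+ 2 in
  0 < 1 - eta ^+ 2 * w ^+ 2 * t1 / c /\
  profile eta (t1 * (1 - eta ^+ 2 * w ^+ 2 * t1 / c)) (eta * s)
    - profile eta t1 (eta * t2) = - D21 y (w, t1, t2) eta :> R.
Proof.
move=> eta0 eta1 t10 t20 s c.
have w0 : 0 <= w ^+ 2 * t1 by rewrite mulr_ge0 ?sqr_ge0 ?ltW.
have s0 : 0 < s by rewrite ltr_wpDl.
have y0 : 0 <= (1 - eta) * y ^+ 2 by rewrite mulr_ge0 ?sqr_ge0// subr_ge0 ltW.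
have c0 : 0 < c by rewrite ltr_wpDr// mulr_gt0.
have d0 : 0 < 1 - eta ^+ 2 * w ^+ 2 * t1 / c.
  rewrite subr_gt0 ltr_pdivrMr// mul1r /c /s.
  rewrite -subr_gt0.
  have -> : eta * (w ^+ 2 * t1 + t2) + (1 - eta) * y ^+ 2 - eta ^+ 2 * w ^+ 2 * t1 =
     eta * (1 - eta) * (w ^+ 2 * t1) + eta * t2 + (1 - eta) * y ^+ 2 by ring.
  apply: ltr_wpDr => //; apply: ltr_wpDl; last exact: mulr_gt0.
  by rewrite mulr_ge0// mulr_ge0 ?subr_ge0 ?ltW.
split => //; rewrite profile_gap ?mulr_gt0// /D21 -/s -/c.
by rewrite lnM ?posrE// ln_div ?posrE//; field.
Qed.

End partial_averages.

(** The five moments that determine both fits, normalised by N. *)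
Lemma cvg_scaled_moments (R : realType) (n m : nat -> nat) (eta : R) (xs ys : nat -> R * R)
    (uu uv vv yy ym : R) :
  0 < eta -> eta < 1 ->
  (forall N, (n N + m N)%N = N) ->
  (fun N => (n N)%:R / N%:R : R) @ \oo --> eta ->
  (fun n => (\sum_(i < n) (1 * (xs i).1 + 0 * (xs i).2) ^+ 2) / n%:R) @ \oo --> uu ->
  (fun n => (\sum_(i < n) (0 * (xs i).1 + 1 * (xs i).2) ^+ 2) / n%:R) @ \oo --> vv ->
  (fun n => (\sum_(i < n) (1 * (xs i).1 + 1 * (xs i).2) ^+ 2) / n%:R) @ \oo -->
    uu + 2 * uv + vv ->
  (fun n => (\sum_(i < n) ((ys i).1 + 0) ^+ 2) / n%:R) @ \oo --> yy ->
  (fun n => (\sum_(i < n) ((ys i).1 + 1) ^+ 2) / n%:R) @ \oo --> yy + 2 * ym + 1 ->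
  [/\ (fun N => (\sum_(i < n N) (xs i).1 ^+ 2) / N%:R) @ \oo --> eta * uu,
      (fun N => (\sum_(i < n N) (xs i).1 * (xs i).2) / N%:R) @ \oo --> eta * uv,
      (fun N => (\sum_(i < n N) (xs i).2 ^+ 2) / N%:R) @ \oo --> eta * vv,
      (fun N => (\sum_(j < m N) (ys j).1 ^+ 2) / N%:R) @ \oo --> (1 - eta) * yy &
      (fun N => (\sum_(j < m N) (ys j).1) / N%:R) @ \oo --> (1 - eta) * ym].
Proof.
move=> eta0 eta1 nm nr h10 h01 h11 g0 g1.
have [cu cv cuv] :=
  @cvg_average_polarization _ (fun i => (xs i).1) (fun i => (xs i).2) _ _ _ h10 h01 h11.
have [cy cm] := @cvg_average_shift _ (fun i => (ys i).1) _ _ g0 g1.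
have eta1' : 0 < 1 - eta by rewrite subr_gt0.
have mr := cvg_m_ratio nm nr.
split.
- exact: (@cvg_partial_average _ (fun i => (xs i).1 ^+ 2) _ _ _ eta0 nr cu).
- exact: (@cvg_partial_average _ (fun i => (xs i).1 * (xs i).2) _ _ _ eta0 nr cuv).
- exact: (@cvg_partial_average _ (fun i => (xs i).2 ^+ 2) _ _ _ eta0 nr cv).
- exact: (@cvg_partial_average _ (fun i => (ys i).1 ^+ 2) _ _ _ eta1' mr cy).
- exact: (@cvg_partial_average _ (fun i => (ys i).1) _ _ _ eta1' mr cm).
Qed.

Theorem theorem4p1 (R : realType) (d : measure_display) (T : measurableType d)
    (P : probability T R) (y eta : R) (n m : nat -> nat)
    (prior : @priors R) (w t1 t2 : R)
    (X Y : nat -> {RV P >-> (R * R)%type})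
    (n_plus_m : forall N, (n N + m N)%N = N)
    (n_incr : {homo n : a b / (a <= b)%N})
    (m_incr : {homo m : a b / (a <= b)%N})
    (eta_gt0 : 0 < eta) (eta_lt1 : eta < 1)
    (n_ratio : (fun N => (n N)%:R / N%:R : R) @ \oo --> eta)
    (prior1_density : prior_density leb3 Theta (prior1 prior))
    (prior2_density : prior_density leb3 Theta (prior2 prior))
    (prior3_density : prior_density leb2 Theta3 (prior3 prior))
    (prior1_smooth : times_differentiable 4 Theta (prior1 prior))
    (prior2_smooth : times_differentiable 4 Theta (prior2 prior))
    (prior3_smooth : times_differentiable 4 Theta3 (prior3 prior))
    (prior1_support : full_support Theta (prior1 prior))
    (prior2_support : full_support Theta (prior2 prior))
    (theta_in : Theta (w, t1, t2)) (w_neq0 : w != 0) :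
  (sampling_model S1 (w, t1, t2) y X Y ->
    {ae P, forall omega,
      (fun N => N%:R^-1 *
         ln ((posterior prior y (n N) (m N)
                (fun i => X i omega) (fun j => Y j omega) S1)^-1 - 1))
      @ \oo --> - D12 y (w, t1, t2) eta}) /\
  (sampling_model S2 (w, t1, t2) y X Y ->
    {ae P, forall omega,
      (fun N => N%:R^-1 *
         ln ((posterior prior y (n N) (m N)
                (fun i => X i omega) (fun j => Y j omega) S2)^-1 - 1))
      @ \oo --> - D21 y (w, t1, t2) eta}).
Proof.
have [t1_gt0 t2_gt0] := theta_in.
have diff1 : forall v, Theta v -> differentiable (prior1 prior) v.
  by case: prior1_smooth.
have diff2 : forall v, Theta v -> differentiable (prior2 prior) v.
  by case: prior2_smooth.
rewrite /= in t1_gt0 t2_gt0.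
have [eta_ge0 bar_gt0] : 0 <= eta /\ 0 < 1 - eta by split; [exact: ltW|rewrite subr_gt0].
have wz z : 0 <= z -> 0 <= w ^+ 2 * z by move=> z0; rewrite mulr_ge0 ?sqr_ge0.
split=> model.
- have h10 : {ae P, forall x, (fun n => (\sum_(i < n)
      (1 * (X i x).1 + 0 * (X i x).2) ^+ 2) / n%:R) @ \oo --> w ^+ 2 * t2 + t1}.
    have -> : w ^+ 2 * t2 + t1 = 1 ^+ 2 * t1 + w ^+ 2 * t2 by ring.
    by apply: (cvg_obs_average t1_gt0 t2_gt0 model) => e /=; ring.
  have h01 : {ae P, forall x, (fun n => (\sum_(i < n)
      (0 * (X i x).1 + 1 * (X i x).2) ^+ 2) / n%:R) @ \oo --> t2}.
    have -> : t2 = 0 ^+ 2 * t1 + 1 ^+ 2 * t2 by ring.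
    by apply: (cvg_obs_average t1_gt0 t2_gt0 model) => e /=; ring.
  have h11 : {ae P, forall x, (fun n => (\sum_(i < n)
      (1 * (X i x).1 + 1 * (X i x).2) ^+ 2) / n%:R) @ \oo -->
      w ^+ 2 * t2 + t1 + 2 * (w * t2) + t2}.
    have -> : w ^+ 2 * t2 + t1 + 2 * (w * t2) + t2 =
      1 ^+ 2 * t1 + (w + 1) ^+ 2 * t2 by ring.
    by apply: (cvg_obs_average t1_gt0 t2_gt0 model) => e /=; ring.
  have g0 : {ae P, forall x, (fun n => (\sum_(i < n) ((Y i x).1 + 0) ^+ 2) / n%:R)
      @ \oo --> w ^+ 2 * y ^+ 2 + t1}.
    have -> : w ^+ 2 * y ^+ 2 + t1 = t1 + (w * y + 0) ^+ 2 by ring.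
    exact: (cvg_int_average t1_gt0 model 0).
  have g1 : {ae P, forall x, (fun n => (\sum_(i < n) ((Y i x).1 + 1) ^+ 2) / n%:R)
      @ \oo --> w ^+ 2 * y ^+ 2 + t1 + 2 * (w * y) + 1}.
    have -> : w ^+ 2 * y ^+ 2 + t1 + 2 * (w * y) + 1 = t1 + (w * y + 1) ^+ 2 by ring.
    exact: (cvg_int_average t1_gt0 model 1).
  near=> omega.
  have [||||| c11 c12 c22 cB2 cB1] := @cvg_scaled_moments _ n m eta
    (fun i => X i omega) (fun j => Y j omega)
    (w ^+ 2 * t2 + t1) (w * t2) t2 (w ^+ 2 * y ^+ 2 + t1) (w * y)
    eta_gt0 eta_lt1 n_plus_m n_ratio.
  + by near: omega; exact: h10.
  + by near: omega; exact: h01.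
  + by near: omega; exact: h11.
  + by near: omega; exact: g0.
  + by near: omega; exact: g1.
  pose xs i := X i omega; pose ys j := Y j omega.
  pose M S N := marginal prior y (n N) (m N) xs ys S.
  have c_gt0 : 0 < eta * t2 + (1 - eta) * y ^+ 2.
    by rewrite ltr_wpDr ?mulr_gt0// mulr_ge0 ?sqr_ge0// ltW.
  have s_gt0 : 0 < w ^+ 2 * t2 + t1 by rewrite ltr_wpDl// wz// ltW.
  have v_gt0 : 0 < w ^+ 2 * y ^+ 2 + t1 by rewrite ltr_wpDl// wz// sqr_ge0.
  (* The fit of the true structure recovers the noise variance t1. *)
  have q1E : eta * (w ^+ 2 * t2 + t1) + (1 - eta) * (w ^+ 2 * y ^+ 2 + t1) -
      (eta * (w * t2) + y * ((1 - eta) * (w * y))) ^+ 2 /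
      (eta * t2 + (1 - eta) * y ^+ 2) = t1.
    by field; rewrite gt_eqF.
  (* The reverse regression leaves the conditional variance of X(2) given X(1). *)
  have q2E : eta * t2 - (eta * (w * t2)) ^+ 2 / (eta * (w ^+ 2 * t2 + t1)) =
      eta * (t1 * t2 / (w ^+ 2 * t2 + t1)).
    by field; rewrite !gt_eqF.
  have p1 : 0 < eta * (w ^+ 2 * t2 + t1) by rewrite mulr_gt0.
  have p2 : 0 < eta * (w ^+ 2 * t2 + t1) + (1 - eta) * (w ^+ 2 * y ^+ 2 + t1).
    by rewrite addr_gt0// mulr_gt0.
  have p3 : 0 < eta * (t1 * t2 / (w ^+ 2 * t2 + t1)).
    by rewrite mulr_gt0// divr_gt0// mulr_gt0.
  rewrite -profile_gap_D12//; apply: (@cvg_log_posterior_odds _ (M S1) (M S2) (M S3)).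
  - have := @marginal_S1_rate _ prior y eta n m xs ys n_plus_m eta_gt0 eta_lt1 n_ratio
      _ _ _ _ _ c11 c12 c22 cB2 cB1.
    by rewrite q1E; apply => //; rewrite mulr_gt0.
  - have := @marginal_S2_rate _ prior y eta n m xs ys n_plus_m eta_gt0 n_ratio
      _ _ _ _ c11 c12 c22 cB2.
    by rewrite q2E; apply.
  - have := @marginal_S3_rate_le_S2 _ prior y eta n m xs ys n_plus_m eta_gt0 n_ratio
      _ _ _ _ c11 c12 c22 cB2.
    by rewrite q2E; apply.
- have h10 : {ae P, forall x, (fun n => (\sum_(i < n)
      (1 * (X i x).1 + 0 * (X i x).2) ^+ 2) / n%:R) @ \oo --> t1}.
    have -> : t1 = 1 ^+ 2 * t1 + 0 ^+ 2 * t2 by ring.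
    by apply: (cvg_obs_average t1_gt0 t2_gt0 model) => e /=; ring.
  have h01 : {ae P, forall x, (fun n => (\sum_(i < n)
      (0 * (X i x).1 + 1 * (X i x).2) ^+ 2) / n%:R) @ \oo --> w ^+ 2 * t1 + t2}.
    have -> : w ^+ 2 * t1 + t2 = w ^+ 2 * t1 + 1 ^+ 2 * t2 by ring.
    by apply: (cvg_obs_average t1_gt0 t2_gt0 model) => e /=; ring.
  have h11 : {ae P, forall x, (fun n => (\sum_(i < n)
      (1 * (X i x).1 + 1 * (X i x).2) ^+ 2) / n%:R) @ \oo -->
      t1 + 2 * (w * t1) + (w ^+ 2 * t1 + t2)}.
    have -> : t1 + 2 * (w * t1) + (w ^+ 2 * t1 + t2) =
      (1 + w) ^+ 2 * t1 + 1 ^+ 2 * t2 by ring.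
    by apply: (cvg_obs_average t1_gt0 t2_gt0 model) => e /=; ring.
  have g0 : {ae P, forall x, (fun n => (\sum_(i < n) ((Y i x).1 + 0) ^+ 2) / n%:R)
      @ \oo --> t1}.
    have -> : t1 = t1 + (0 + 0) ^+ 2 by ring.
    exact: (cvg_int_average t1_gt0 model 0).
  have g1 : {ae P, forall x, (fun n => (\sum_(i < n) ((Y i x).1 + 1) ^+ 2) / n%:R)
      @ \oo --> t1 + 2 * 0 + 1}.
    have -> : t1 + 2 * 0 + 1 = t1 + (0 + 1) ^+ 2 by ring.
    exact: (cvg_int_average t1_gt0 model 1).
  near=> omega.
  have [||||| c11 c12 c22 cB2 cB1] := @cvg_scaled_moments _ n m eta
    (fun i => X i omega) (fun j => Y j omega)
    t1 (w * t1) (w ^+ 2 * t1 + t2) t1 0 eta_gt0 eta_lt1 n_plus_m n_ratio.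
  + by near: omega; exact: h10.
  + by near: omega; exact: h01.
  + by near: omega; exact: h11.
  + by near: omega; exact: g0.
  + by near: omega; exact: g1.
  pose xs i := X i omega; pose ys j := Y j omega.
  pose M S N := marginal prior y (n N) (m N) xs ys S.
  have s_gt0 : 0 < w ^+ 2 * t1 + t2 by rewrite ltr_wpDl// wz// ltW.
  have c_gt0 : 0 < eta * (w ^+ 2 * t1 + t2) + (1 - eta) * y ^+ 2.
    by rewrite ltr_wpDr ?mulr_gt0// mulr_ge0 ?sqr_ge0// ltW.
  have [d_gt0 <-] := profile_gap_D21 y w eta_gt0 eta_lt1 t1_gt0 t2_gt0.
  have q1E : eta * t1 + (1 - eta) * t1 -
      (eta * (w * t1) + y * ((1 - eta) * 0)) ^+ 2 /
      (eta * (w ^+ 2 * t1 + t2) + (1 - eta) * y ^+ 2) =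
      t1 * (1 - eta ^+ 2 * w ^+ 2 * t1 /
            (eta * (w ^+ 2 * t1 + t2) + (1 - eta) * y ^+ 2)).
    by field; rewrite gt_eqF.
  (* The fit of the true structure recovers the noise variance t2. *)
  have q2E : eta * (w ^+ 2 * t1 + t2) - (eta * (w * t1)) ^+ 2 / (eta * t1) = eta * t2.
    by field; rewrite !gt_eqF.
  have t1E : eta * t1 + (1 - eta) * t1 = t1 by ring.
  rewrite /posterior; under eq_fun do rewrite [marginal _ _ _ _ _ _ S1 + _]addrC.
  apply: (@cvg_log_posterior_odds _ (M S2) (M S1) (M S3)).
  - have := @marginal_S2_rate _ prior y eta n m xs ys n_plus_m eta_gt0 n_ratio
      _ _ _ _ c11 c12 c22 cB2.
    by rewrite q2E t1E; apply => //; rewrite ?mulr_gt0.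
  - have := @marginal_S1_rate _ prior y eta n m xs ys n_plus_m eta_gt0 eta_lt1 n_ratio
      _ _ _ _ _ c11 c12 c22 cB2 cB1.
    by rewrite q1E; apply => //; rewrite ?mulr_gt0.
  - have := @marginal_S3_rate_le_S1 _ prior y eta n m xs ys n_plus_m eta_gt0 eta_lt1 n_ratio
      _ _ _ _ _ c11 c12 c22 cB2 cB1.
    by rewrite q1E; apply => //; rewrite ?mulr_gt0.
Unshelve. all: by end_near. Qed.
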